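(* For every $r\in\mathbb N$ there exist constants $c>0$, $C>0$ such that for all $f\in\mathbf E$ and all $s>0$, $$c\,\Omega^{r}(s,f)\le K(s^{r},f,\mathbf E,\mathbf E^{r})\le C\big(\Omega^{r}(s,f)+\min(s^{r},1)\|f\|_{\mathbf E}\big).$$
   Context: Let $G=\mathbb R_+\times\mathbb R$ be the ''$ax+b$'' group with multiplication $(a_1,b_1)(a_2,b_2)=(a_1a_2,\,a_1b_2+b_1)$. Let $T$ be a strongly continuous representation of $G$ in a Banach space $\mathbf E$ with $\|T(g)f\|_{\mathbf E}\le\|f\|_{\mathbf E}$ for all $g,f$. Put $T_1(t)=T(e^{t},0)$, $T_2(t)=T(1,t)$, $t\in\mathbb R$, with (closed) infinitesimal generators $\mathbb A_1,\mathbb A_2$. For $r\in\mathbb N$, $\mathbf E^{r}$ is the space of $f\in\mathbf E$ for which all products $\mathbb A_{j_1}\cdots\mathbb A_{j_k}f$, $1\le k\le r$, $j_i\in\{1,2\}$, are defined, with norm $\|f\|_{\mathbf E^r}=\|f\|_{\mathbf E}+\sum_{k=1}^r\sum_{(j_1,\dots,j_k)\in\{1,2\}^k}\|\mathbb A_{j_1}\cdots\mathbb A_{j_k}f\|_{\mathbf E}$. The mixed modulus of continuity is $$\Omega^{r}(s,f)=\sum_{(j_1,\dots,j_r)\in\{1,2\}^r}\ \sup_{0\le t_{1},\dots,t_{r}\le s}\big\|(T_{j_1}(t_{1})-I)\cdots(T_{j_r}(t_{r})-I)f\big\|_{\mathbf E}.$$ The $K$-functional is $K(t,f,\mathbf E,\mathbf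 E^r)=\inf\{\|f_0\|_{\mathbf E}+t\|f_1\|_{\mathbf E^r}: f=f_0+f_1,\ f_0\in\mathbf E,\ f_1\in\mathbf E^r\}$. *)

(* Defs.v *)
From HB Require Import structures.
From mathcomp Require Import all_boot all_order all_algebra.
From mathcomp Require Import all_classical all_reals all_analysis.
Set Implicit Arguments. Unset Strict Implicit. Unset Printing Implicit Defensive.
Import Order.TTheory GRing.Theory Num.Theory.
Import numFieldNormedType.Exports.
Local Open Scope classical_set_scope.
Local Open Scope ring_scope.

Section AxB.
Variables (R : realType) (E : completeNormedModType R).

(* T a b represents T((a,b)) for a > 0. *)
Definition is_contr_rep_axb (T : R -> R -> E -> E) : Prop :=
  (forall a b, 0 < a -> forall f g : E, T a b (f + g) = T a b f + T a b g) /\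
      (forall a b, 0 < a -> forall (k : R) (f : E), T a b (k *: f) = k *: T a b f) /\
      (forall f, T 1 0 f = f) /\
      (forall a1 b1 a2 b2, 0 < a1 -> 0 < a2 -> forall f,
          T (a1 * a2) (a1 * b2 + b1) f = T a1 b1 (T a2 b2 f)) /\
      (forall f : E, {within [set p : R * R | 0 < p.1],
                      continuous (fun p : R * R => T p.1 p.2 f)}) /\
      (forall a b, 0 < a -> forall f : E, `|T a b f| <= `|f|).

(* one-parameter subgroups: index false = T_1, true = T_2 *)
Definition Tj (T : R -> R -> E -> E) (j : bool) (t : R) : E -> E :=
  if j then T 1 t else T (expR t) 0.

Definition gen_quot T j (f : E) := fun t : R => t^-1 *: (Tj T j t f - f).
Definition Adom T j (f : E) : Prop := cvg (gen_quot T j f @ 0^'+).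
Definition Aop T j (f : E) : E := lim (gen_quot T j f @ 0^'+).

Definition wapp T (w : seq bool) (f : E) : E := foldr (Aop T) f w.
Fixpoint wdom T (w : seq bool) (f : E) : Prop :=
  match w with
  | [::] => True
  | j :: w' => wdom T w' f /\ Adom T j (wapp T w' f)
  end.

Definition inEr T (r : nat) (f : E) : Prop :=
  forall w : seq bool, (1 <= size w <= r)%N -> wdom T w f.

Definition normEr T (r : nat) (f : E) : R :=
  `|f| + \sum_(1 <= k < r.+1) \sum_(w : k.-tuple bool) `|wapp T w f|.

Definition Kfun T (r : nat) (t : R) (f : E) : R :=
  inf [set x : R | exists f1 : E, inEr T r f1 /\ x = `|f - f1| + t * normEr T r f1].

Definition dapp T (l : seq (bool * R)) (f : E) : E :=
  foldr (fun p g => Tj T p.1 p.2 g - g) f l.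

Definition Omega T (r : nat) (s : R) (f : E) : R :=
  \sum_(w : r.-tuple bool)
    sup [set x : R | exists ts : r.-tuple R,
           (forall i : 'I_r, 0 <= tnth ts i <= s) /\
           x = `|dapp T (zip w ts) f|].

End AxB.

(* Main.v *)
(* Let [M_j = s^-1 \int_0^s T_j(t) dt], [P = M_2^r M_1^r] and, for [s <= 1/2],
   approximate [f] by [g = f - (I - P)^r f]. Since [P] is an average of products
   of [T_j(t)] with [0 <= t <= s], each factor [I - P] gains one order of
   difference, so [|f - g| <= C Omega^r(s, f)].

   Derivatives of [g] are controlled by [A_2 M_2 = s^-1 (T_2(s) - I)],
   [A_1 M_1 = s^-1 (T_1(s) - I)] and the commutation rule
   [A_1 M_2 = M_2 A_1 + T_2(s) - M_2], which trade a derivative for a difference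
   up to terms of lower order: [|g|_(E^r) <= C \sum_(k <= r) s^-k Omega^k(s, f)].
   For [k < r] one has [Omega^k(s, f) <= C (|f - g| + s^k |g|_(E^k))], and by
   Landau-Kolmogorov interpolation [|g|_(E^(r-1)) <= e |g|_(E^r) + C_e |g|], so
   the lower order terms are absorbed without a Marchaud inequality.

   The left estimate follows from [|(T_j(t) - I) g|_(E^m) <= C t |g|_(E^(m+1))]. *)
Require Import Defs.
From HB Require Import structures.
From mathcomp Require Import all_boot all_order all_algebra.
From mathcomp Require Import all_classical all_reals all_analysis.
From mathcomp Require Import ring lra.
Import Order.TTheory GRing.Theory Num.Theory.
Import numFieldNormedType.Exports.
Local Open Scope classical_set_scope.
Local Open Scope ring_scope.
Set Implicit Arguments. Unset Strict Implicit. Unset Printing Implicit Defensive.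

(** * Linear identities in modules *)

(** The obstacle is that T_1 rescales T_2: (e^u,0)(1,t) = (1,e^u t)(e^u,0). Moving a generator past
    T_j(t), with 0 <= t <= 1, leaves an extra term A_2 with a coefficient of size at most t; moving
    a difference past it changes the step or adds a second difference. For s <= 1/2 the changed
    steps stay in [0, s]. For larger s the upper estimate is trivial: take f_1 = 0 and use min(s^r,
    1) >= 2^-r.

    The commutator T_2(s) - M_2 is estimated without using any cancellation, so a derivative of
    order m of P f is controlled by s^-i Omega^i for all i <= m together, not by i = m alone. The
    seminorm [qsn] collects these terms, and derivatives are measured in it ([sob] with a general
    seminorm), so that a difference standing outside an average can still be counted.

    Integrals of orbits are built as primitives on the half-line: uniqueness of primitives yields
    the integral identities, and one mean value inequality, valid for every bounded seminorm, yields
    the estimates of averages in the norm and in the difference seminorms alike. *)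

Section LinearIdentities.
Variables (R : realType) (E : lmodType R).

Inductive lmod_expr :=
  | LVar of nat
  | LZero
  | LAdd of lmod_expr & lmod_expr
  | LOpp of lmod_expr
  | LScale of R & lmod_expr.

Fixpoint lmod_eval (env : seq E) (e : lmod_expr) : E :=
  match e with
  | LVar i => nth 0 env i
  | LZero => 0
  | LAdd a b => lmod_eval env a + lmod_eval env b
  | LOpp a => - lmod_eval env a
  | LScale c a => c *: lmod_eval env a
  end.

Fixpoint lmod_coef (e : lmod_expr) (i : nat) : R :=
  match e with
  | LVar j => if Nat.eqb i j then 1 else 0
  | LZero => 0
  | LAdd a b => lmod_coef a i + lmod_coef b i
  | LOpp a => - lmod_coef a i
  | LScale c a => c * lmod_coef a i
  end.

(** A recursive conjunction, not a bounded quantifier, so that [cbn] unfolds it into one scalar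
    equation per atom, each within reach of [ring] or [field]. *)
Fixpoint lmod_coef_eq (n : nat) (e1 e2 : lmod_expr) : Prop :=
  match n with
  | 0 => True
  | n'.+1 => lmod_coef e1 n' = lmod_coef e2 n' /\ lmod_coef_eq n' e1 e2
  end.

Lemma lmod_evalE (env : seq E) (e : lmod_expr) :
  lmod_eval env e = \sum_(i < size env) lmod_coef e i *: nth 0 env i.
Proof.
elim: e => [j||a IHa b IHb|a IHa|c a IHa] /=.
- have [jn|nj] := ltnP j (size env).
    rewrite (bigD1 (Ordinal jn)) //= PeanoNat.Nat.eqb_refl scale1r big1 ?addr0 //.
    move=> i; rewrite -val_eqE /= => ij.
    case: (PeanoNat.Nat.eqb_spec i j) => [ij'|_]; last by rewrite scale0r.
    by rewrite ij' eqxx in ij.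
  rewrite nth_default // big1 // => i _.
  case: (PeanoNat.Nat.eqb_spec i j) => [ij|_]; last by rewrite scale0r.
  by have := ltn_ord i; rewrite ij ltnNge nj.
- by rewrite big1 // => i _; rewrite scale0r.
- by rewrite IHa IHb -big_split /=; apply: eq_bigr => i _; rewrite scalerDl.
- by rewrite IHa -sumrN; apply: eq_bigr => i _; rewrite scaleNr.
- by rewrite IHa scaler_sumr; apply: eq_bigr => i _; rewrite scalerA.
Qed.

Lemma lmod_eval_eq (env : seq E) (e1 e2 : lmod_expr) :
  lmod_coef_eq (size env) e1 e2 -> lmod_eval env e1 = lmod_eval env e2.
Proof.
rewrite !lmod_evalE; elim: (size env) => [|n IHn] /=; first by rewrite !big_ord0.
by case=> en /IHn IH; rewrite !big_ord_recr /= IH en.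
Qed.

End LinearIdentities.

(** Compares atoms by unification instead of syntax. The inner [match] runs the tactic [unify] while
    a term is being computed, and the outer one turns its failure into [false]. *)
Ltac lmod_same x y :=
  match constr:(tt) with
  | _ => let _ := match constr:(tt) with _ => unify x y end in constr:(true)
  | _ => constr:(false)
  end.
Ltac lmod_index x env :=
  lazymatch env with
  | ?y :: ?env' =>
    lazymatch lmod_same x y with
    | true => constr:(0%N)
    | false => let n := lmod_index x env' in constr:(n.+1)
    end
  end.
Ltac lmod_insert x env :=
  let rec mem l :=
    lazymatch l with
    | nil => constr:(false)
    | ?y :: ?l' =>
      lazymatch lmod_same x y with
      | true => constr:(true)
      | false => mem l'
      end
    end in
  lazymatch mem env with
  | true => env
  | false => constr:(x :: env)
  end.
Ltac lmod_atoms e env :=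
  lazymatch e with
  | (?a + ?b)%R => let env1 := lmod_atoms a env in lmod_atoms b env1
  | (- ?a)%R => lmod_atoms a env
  | (_ *: ?a)%R => lmod_atoms a env
  | (0)%R => env
  | _ => lmod_insert e env
  end.
Ltac lmod_reify R e env :=
  lazymatch e with
  | (?a + ?b)%R => let a' := lmod_reify R a env in
                   let b' := lmod_reify R b env in constr:(@LAdd R a' b')
  | (- ?a)%R => let a' := lmod_reify R a env in constr:(@LOpp R a')
  | (?c *: ?a)%R => let a' := lmod_reify R a env in constr:(@LScale R c a')
  | (0)%R => constr:(@LZero R)
  | _ => let i := lmod_index e env in constr:(@LVar R i)
  end.

(* Reduces an equation between linear combinations in a module over a
   realType to the equality of the coefficients of each atom. *)
Ltac lmod_coefs :=
  lazymatch goal with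
  | R : realType |- @eq ?E ?x ?y =>
    let env0 := lmod_atoms x (@nil E) in
    let env := lmod_atoms y env0 in
    let e1 := lmod_reify R x env in
    let e2 := lmod_reify R y env in
    apply: (@lmod_eval_eq R _ env e1 e2);
    cbn [lmod_coef lmod_coef_eq size Nat.eqb]; repeat split
  end.
Ltac lmod := lmod_coefs; ring.

(** * Primitives of Banach-valued functions *)

Section Primitives.
Variables (R : realType) (E : completeNormedModType R).
Implicit Types (p : E -> R) (F G phi : R -> E) (a b c e K : R).

(** Domination by the norm lets a remainder that is small in norm be small for [p]. The instances
    are the norm, [dsn] and [qsn]. *)
Definition bounded_seminorm p : Prop :=
  [/\ forall x y : E, p (x + y) <= p x + p y,
      forall c (x : E), p (c *: x) = `|c| * p x &
      exists2 C, 0 <= C & forall x : E, p x <= C * `|x|].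

Lemma bounded_seminorm_norm : bounded_seminorm (fun x => `|x|).
Proof.
split; [exact: ler_normD|exact: normrZ|].
by exists 1 => // x; rewrite mul1r.
Qed.

Section Seminorm.
Variables (p : E -> R) (hp : bounded_seminorm p).

Lemma bsn_leD x y : p (x + y) <= p x + p y. Proof. by case: hp. Qed.

Lemma bsnZ c x : p (c *: x) = `|c| * p x. Proof. by case: hp. Qed.

Lemma bsn0 : p 0 = 0.
Proof. by rewrite -(scale0r (0 : E)) bsnZ normr0 mul0r. Qed.

Lemma bsnN x : p (- x) = p x.
Proof. by rewrite -scaleN1r bsnZ normrN1 mul1r. Qed.

Lemma bsn_leB x y : p (x - y) <= p x + p y.
Proof. by rewrite -(bsnN y) bsn_leD. Qed.

Lemma bsn_ge0 x : 0 <= p x.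
Proof. by have := bsn_leB x x; rewrite subrr bsn0; lra. Qed.

(* Real induction along the supremum of the points up to which the bound holds. *)
Lemma lipschitz_of_local G (a b K : R) : a <= b ->
  (forall x : R, a <= x <= b -> exists2 d : R, 0 < d &
     forall y : R, a <= y <= b -> `|y - x| < d -> p (G y - G x) <= K * `|y - x|) ->
  p (G b - G a) <= K * (b - a).
Proof.
move=> ab loc.
pose S := [set x | a <= x <= b /\ p (G x - G a) <= K * (x - a)].
have Sa : S a by split; [rewrite lexx ab|rewrite !subrr bsn0 mulr0].
have supS : has_sup S.
  by split; [exists a|exists b => x [/andP[]]].
set c := sup S.
have ac : a <= c by apply: ub_le_sup => //; case: supS.
have cb : c <= b by apply: ge_sup; [exists a|move=> x [/andP[]]].
have [|d d0 hd] := loc c; first by rewrite ac cb.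
have Sc : S c.
  split; first by rewrite ac cb.
  have [x Sx xc] := sup_adherent d0 supS.
  have xlec : x <= c by apply: ub_le_sup => //; case: supS.
  case: Sx => /andP[ax xb] Sx.
  have hx : p (G c - G x) <= K * (c - x).
    rewrite -bsnN opprB.
    have -> : c - x = `|x - c| by rewrite distrC ger0_norm // subr_ge0.
    apply: hd; first by rewrite ax xb.
    by rewrite distrC ger0_norm ?subr_ge0 // -/c in xc *; lra.
  have -> : G c - G a = (G c - G x) + (G x - G a) by lmod.
  apply: le_trans (bsn_leD _ _) _.
  by apply: le_trans (lerD hx Sx) _; rewrite -mulrDr; have -> : c - x + (x - a) = c - a by ring.
have [cb'|bc] := ltP c b; last first.
  have -> : b = c by apply/eqP; rewrite eq_le bc cb.
  by case: Sc.
pose y := Num.min b (c + d / 2).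
have cy : c < y by rewrite lt_min cb' /=; lra.
have yb : y <= b by rewrite ge_min lexx.
have yd : y <= c + d / 2 by rewrite ge_min lexx orbT.
suff Sy : S y by have : y <= c by [apply: ub_le_sup => //; case: supS]; lra.
split; first by apply/andP; split=> //; lra.
have hy : p (G y - G c) <= K * (y - c).
  have yE : y - c = `|y - c| by rewrite ger0_norm // subr_ge0 ltW.
  rewrite [X in _ * X]yE; apply: hd; first by apply/andP; split=> //; lra.
  by rewrite -yE; lra.
have -> : G y - G a = (G y - G c) + (G c - G a) by lmod.
apply: le_trans (bsn_leD _ _) _; case: Sc => _ Sc.
by apply: le_trans (lerD hy Sc) _; rewrite -mulrDr; have -> : y - c + (c - a) = y - a by ring.
Qed.

End Seminorm.

(* [F' = phi] on the half-line [0, +oo), one-sidedly at [0]. *)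
Definition primitive F phi : Prop :=
  forall x : R, 0 <= x -> forall e : R, 0 < e -> exists2 d : R, 0 < d &
    forall y : R, 0 <= y -> `|y - x| < d ->
      `|F y - F x - (y - x) *: phi x| <= e * `|y - x|.

Definition cont_nonneg phi : Prop :=
  forall x : R, 0 <= x -> forall e : R, 0 < e -> exists2 d : R, 0 < d &
    forall y : R, 0 <= y -> `|y - x| < d -> `|phi y - phi x| <= e.

Lemma primitive_mean_value p (hp : bounded_seminorm p) F phi a b K :
  primitive F phi -> 0 <= a -> a <= b ->
  (forall x, a <= x <= b -> p (phi x) <= K) -> p (F b - F a) <= K * (b - a).
Proof.
move=> Fphi a0 ab phiK; have [_ _ [C C0 pC]] := hp.
apply/ler_addgt0Pr => e e0.
(* Chosen so that [C * e1 * (b - a) <= e]; the summands 1 keep the denominator positive when [C = 0]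
   or [a = b]. *)
pose e1 := e / ((C + 1) * (b - a + 1)).
have den0 : 0 < (C + 1) * (b - a + 1) by apply: mulr_gt0; lra.
have e10 : 0 < e1 by rewrite divr_gt0.
have : p (F b - F a) <= (K + C * e1) * (b - a).
  apply: (lipschitz_of_local hp) => // x /andP[ax xb].
  have [|d d0 hd] := Fphi x _ e1 e10; first by lra.
  exists d => // y /andP[ay yb] yx.
  have -> : F y - F x = (F y - F x - (y - x) *: phi x) + (y - x) *: phi x by lmod.
  apply: le_trans (bsn_leD hp _ _) _.
  rewrite mulrDl addrC lerD // ?(bsnZ hp) ?[K * _]mulrC ?ler_wpM2l //.
    by apply: phiK; rewrite ax xb.
  rewrite -mulrA; apply: le_trans (pC _) _; apply: ler_wpM2l => //.
  by apply: hd => //; lra.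
move=> /le_trans; apply; rewrite mulrDl lerD2l.
have -> : C * e1 * (b - a) = e * ((C * (b - a)) / ((C + 1) * (b - a + 1))).
  by rewrite /e1; field; apply/andP; split; apply: lt0r_neq0; lra.
rewrite -[leRHS]mulr1 ler_wpM2l ?(ltW e0) // ler_pdivrMr // mul1r.
by nra.
Qed.

Lemma primitive_unique F G phi (x : R) : primitive F phi -> primitive G phi ->
  F 0 = G 0 -> 0 <= x -> F x = G x.
Proof.
move=> HF HG FG0 x0.
have HFG : primitive (fun t => F t - G t) (fun=> 0).
  move=> u u0 e e0; have e20 : 0 < e / 2 by lra.
  have [d1 d10 h1] := HF u u0 _ e20; have [d2 d20 h2] := HG u u0 _ e20.
  exists (Num.min d1 d2); first by rewrite lt_min d10 d20.
  move=> y y0; rewrite lt_min => /andP[y1 y2].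
  have -> : F y - G y - (F u - G u) - (y - u) *: 0 =
    (F y - F u - (y - u) *: phi u) - (G y - G u - (y - u) *: phi u) by lmod.
  apply: le_trans (ler_normB _ _) _.
  by have := h1 _ y0 y1; have := h2 _ y0 y2; lra.
have := primitive_mean_value (K := 0) bounded_seminorm_norm HFG (lexx 0) x0.
rewrite FG0 subrr subr0 mul0r => h.
apply/eqP; rewrite -subr_eq0 -normr_le0; apply: h => u _.
by rewrite normr0.
Qed.

(** The model is a polygon whose slope stays within [e] of [phi] on [0, b]; such functions take the
    place of Riemann sums in the construction of the integral. *)
Definition approx_primitive phi e b G : Prop :=
  G 0 = 0 /\ forall x : R, 0 <= x <= b -> exists2 d : R, 0 < d &
    forall y : R, 0 <= y <= b -> `|y - x| < d ->
      `|G y - G x - (y - x) *: phi x| <= e * `|y - x|.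

Lemma approx_primitive_extend phi e c b G : 0 <= e -> 0 <= c <= b ->
  (forall t, c <= t <= b -> `|phi c - phi t| <= e) ->
  approx_primitive phi e c G ->
  approx_primitive phi e b
    (fun y => if y <= c then G y else G c + (y - c) *: phi c).
Proof.
move=> e0 /andP[c0 cb] hphi [G0 hG]; split; first by rewrite c0.
move=> x /andP[x0 xb]; have [xc|cx] := leP x c; last first.
  exists (x - c); first by rewrite subr_gt0.
  move=> y /andP[y0 yb] yx.
  have cy : c < y by move: yx; rewrite ltr_distlC => /andP[]; lra.
  rewrite (ltNge c y) in cy; rewrite (negbTE cy).
  have -> : G c + (y - c) *: phi c - (G c + (x - c) *: phi c) - (y - x) *: phi x
    = (y - x) *: (phi c - phi x) by lmod.
  by rewrite normrZ mulrC ler_wpM2r // hphi // xb ltW.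
have [|d d0 hd] := hG x; first by rewrite x0 xc.
have [xc'|cx] := ltP x c.
  exists (Num.min d (c - x)); first by rewrite lt_min d0 subr_gt0.
  move=> y /andP[y0 yb]; rewrite lt_min => /andP[yd yxc].
  have yc : y <= c by move: yxc; rewrite ltr_distlC => /andP[]; lra.
  by rewrite yc; apply: hd => //; rewrite y0 yc.
(* At the junction the left side uses the old function and the right side the affine piece, whose
   error there is exactly 0. *)
have {xc cx x0 xb} xc : x = c by lra.
subst x; exists d => // y /andP[y0 yb] yd.
have [yc|cy] := leP y c; first by apply: hd => //; rewrite y0 yc.
have -> : G c + (y - c) *: phi c - G c - (y - c) *: phi c = 0 by lmod.
by rewrite normr0 mulr_ge0.
Qed.

(** Let [c] be the supremum of the reachable endpoints. Continuity at [c] allows an affine extension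
    from an endpoint just before [c] to one beyond it, unless [b] comes first. *)
Lemma approx_primitive_ex phi e b : cont_nonneg phi -> 0 < e -> 0 <= b ->
  exists G, approx_primitive phi e b G.
Proof.
move=> cphi e0 b0.
pose S := [set x | 0 <= x <= b /\ exists G, approx_primitive phi e x G].
have S0 : S 0.
  split; first by rewrite lexx b0.
  exists (fun=> 0); split=> // x x0; exists 1 => // y y0 _.
  have -> : x = 0 by lra.
  have -> : y = 0 by lra.
  by rewrite !subrr scale0r !subr0 !normr0 mulr0.
have supS : has_sup S.
  by split; [exists 0|exists b => x [/andP[]]].
set c := sup S.
have c0 : 0 <= c by apply: ub_le_sup => //; case: supS.
have cb : c <= b by apply: ge_sup; [exists 0|move=> x [/andP[]]].
(* Both the slope [phi x] of the new piece and the values [phi t] along it are compared with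
   [phi c], hence the half. *)
have e20 : 0 < e / 2 by lra.
have [d d0 hd] := cphi c c0 _ e20.
have [x [/andP[x0 xb] [G hG]] xc] := sup_adherent d0 supS.
have xlec : x <= c.
  by apply: ub_le_sup; [case: supS|split; [rewrite x0 xb|exists G]].
rewrite -/c in xc.
pose y := Num.min b (c + d / 2).
have yb : y <= b by rewrite ge_min lexx.
have yd : y <= c + d / 2 by rewrite ge_min lexx orbT.
have cy : c <= y by rewrite le_min cb /=; lra.
have Sy : S y.
  split; first by rewrite yb andbT; lra.
  exists (fun z => if z <= x then G z else G x + (z - x) *: phi x).
  apply: approx_primitive_extend hG; [lra|by rewrite x0 /=; lra|].
  move=> t /andP[xt ty].
  have -> : phi x - phi t = (phi x - phi c) - (phi t - phi c) by lmod.
  have h1 := hd x x0; have h2 := hd t (le_trans x0 xt).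
  apply: le_trans (ler_normB _ _) _.
  have {}h1 : `|phi x - phi c| <= e / 2.
    by apply: h1; rewrite ltr_distlC; lra.
  have {}h2 : `|phi t - phi c| <= e / 2.
    by apply: h2; rewrite ltr_distlC; lra.
  lra.
have yc : y <= c by apply: ub_le_sup => //; case: supS.
suff -> : b = y by case: Sy.
have [bcd|cdb] := leP b (c + d / 2); first by rewrite /y min_l.
by move: yc; rewrite /y min_r ?(ltW cdb) //; lra.
Qed.

Lemma approx_primitive_diff phi e1 e2 b1 b2 G1 G2 (x y : R) :
  approx_primitive phi e1 b1 G1 -> approx_primitive phi e2 b2 G2 ->
  0 <= x <= y -> y <= b1 -> y <= b2 ->
  `|(G1 y - G2 y) - (G1 x - G2 x)| <= (e1 + e2) * (y - x).
Proof.
move=> [_ h1] [_ h2] /andP[x0 xy] yb1 yb2.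
apply: (lipschitz_of_local bounded_seminorm_norm
  (G := fun t => G1 t - G2 t)) => // t /andP[xt ty].
have [|d1 d10 {}h1] := h1 t; first by lra.
have [|d2 d20 {}h2] := h2 t; first by lra.
exists (Num.min d1 d2); first by rewrite lt_min d10 d20.
move=> z /andP[xz zy]; rewrite lt_min => /andP[z1 z2].
have -> : G1 z - G2 z - (G1 t - G2 t) =
  (G1 z - G1 t - (z - t) *: phi t) - (G2 z - G2 t - (z - t) *: phi t) by lmod.
apply: le_trans (ler_normB _ _) _; rewrite mulrDl lerD //.
  by apply: h1 => //; lra.
by apply: h2 => //; lra.
Qed.

Lemma primitive_ex phi : cont_nonneg phi -> exists F, F 0 = 0 /\ primitive F phi.
Proof.
move=> cphi.
(* Accuracy and interval improve together: error 1/(n+1) on [0, n], so that every point is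
   eventually covered and a diagonal limit exists. *)
have /choice[G hG] : forall n : nat, exists G,
    approx_primitive phi (n.+1%:R^-1) n%:R G.
  by move=> n; apply: approx_primitive_ex.
have inv0 (n : nat) : 0 < n.+1%:R^-1 :> R by rewrite invr_gt0.
have small (e : R) : 0 < e -> exists n0, forall n, (n0 <= n)%N -> n.+1%:R^-1 <= e.
  move=> e0; exists (Num.truncn e^-1) => n hn.
  rewrite invf_ple ?posrE //.
  apply: ltW; apply: lt_le_trans (truncnS_gt _) _.
  by rewrite ler_nat ltnS.
have big (x : R) : exists n0, forall n, (n0 <= n)%N -> x <= n%:R.
  exists (Num.truncn x).+1 => n hn.
  by apply: ltW; apply: lt_le_trans (truncnS_gt _) _; rewrite ler_nat.
have Gdiff x n m : 0 <= x -> x <= n%:R -> x <= m%:R ->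
    `|G n x - G m x| <= (n.+1%:R^-1 + m.+1%:R^-1) * x.
  move=> x0 xn xm.
  have := approx_primitive_diff (hG n) (hG m) (x := 0) (y := x).
  by case: (hG n) => -> _; case: (hG m) => -> _; rewrite !subr0; apply; rewrite ?lexx.
have Gcvg x : 0 <= x -> cvg ((fun n => G n x) @ \oo).
  move=> x0; apply/cauchy_cvgP/cauchy_exP => e e0.
  have [|n1 hn1] := small (e / (4 * (x + 1))).
    by rewrite divr_gt0 // mulr_gt0 //; lra.
  have [n2 hn2] := big x.
  pose N := maxn n1 n2; exists (G N x).
  exists N => // n /= Nn; rewrite -ball_normE /=.
  have NN : (N <= N)%N by [].
  apply: le_lt_trans (Gdiff _ _ _ x0 _ _) _.
  - by apply: hn2; rewrite leq_maxr.
  - by apply: hn2; apply: leq_trans Nn; rewrite leq_maxr.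
  have k1 := hn1 N (leq_maxl _ _).
  have k2 := hn1 n (leq_trans (leq_maxl _ _) Nn).
  apply: (@le_lt_trans _ _ (e / (2 * (x + 1)) * x)).
    rewrite ler_wpM2r //; apply: le_trans (lerD k1 k2) _.
    by rewrite le_eqVlt; apply/orP; left; apply/eqP; field; lra.
  rewrite mulrAC ltr_pdivrMr; first by nra.
  by lra.
pose F x := lim ((fun n => G n x) @ \oo).
have Flim x e : 0 <= x -> 0 < e ->
    exists n0, forall m, (n0 <= m)%N -> `|F x - G m x| <= e.
  move=> x0 e0; have /cvgrPdist_le /(_ _ e0) [n0 _ hn0] := Gcvg x x0.
  by exists n0 => m hm; apply: hn0.
(* Pointwise convergence alone would not give a derivative. Letting m tend to infinity in the
   Lipschitz bound for G_m - G_n shows that F - G_n has Lipschitz constant 2/(n+1), so F inherits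
   the difference quotients of G_n. *)
have Fdiff n x y : 0 <= x <= y -> y <= n%:R ->
    `|(F y - G n y) - (F x - G n x)| <= (n.+1%:R^-1 + n.+1%:R^-1) * (y - x).
  move=> /andP[x0 xy] yn; apply/ler_addgt0Pr => e e0.
  have e20 : 0 < e / 2 by lra.
  have [m1 h1] := Flim x _ x0 e20.
  have [m2 h2] := Flim y _ (le_trans x0 xy) e20.
  pose m := maxn n (maxn m1 m2).
  have {}h1 := h1 m; have {}h2 := h2 m.
  have -> : F y - G n y - (F x - G n x) =
    ((F y - G m y) - (F x - G m x)) + ((G m y - G n y) - (G m x - G n x)) by lmod.
  apply: le_trans (ler_normD _ _) _; rewrite addrC lerD //; last first.
    apply: le_trans (ler_normB _ _) _.
    have -> : e = e / 2 + e / 2 by field.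
    by rewrite lerD // ?h2 ?h1 // /m !leq_max leqnn ?orbT.
  have nm : (n <= m)%N by rewrite leq_maxl.
  have [] : 0 <= x <= y /\ y <= m%:R.
    by rewrite x0 xy; split=> //; apply: le_trans yn _; rewrite ler_nat.
  move=> xy' ym; apply: le_trans (approx_primitive_diff (hG m) (hG n) xy' ym yn) _.
  rewrite ler_wpM2r ?subr_ge0 // lerD2r lef_pV2 ?posrE //.
  by rewrite ler_nat ltnS.
exists F; split.
  rewrite /F; have -> : (fun n => G n 0) = (fun=> 0).
    by apply/funext => n; case: (hG n).
  exact: lim_cst.
move=> x x0 e e0; have e30 : 0 < e / 3 by lra.
have [n1 hn1] := small _ e30; have [n2 hn2] := big (x + 1).
pose n := maxn n1 n2.
have hn := hn1 n (leq_maxl _ _); have xn := hn2 n (leq_maxr _ _).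
have [_ /(_ x)[|d d0 hd]] := hG n; first by rewrite x0 /=; lra.
exists (Num.min d 1); first by rewrite lt_min d0 /=.
move=> y y0; rewrite lt_min => /andP[yd y1].
have yn : y <= n%:R by move: y1; rewrite ltr_distlC => /andP[]; lra.
have -> : F y - F x - (y - x) *: phi x =
  ((F y - G n y) - (F x - G n x)) + (G n y - G n x - (y - x) *: phi x) by lmod.
apply: le_trans (ler_normD _ _) _.
have -> : e * `|y - x| = (e / 3 + e / 3) * `|y - x| + (e / 3) * `|y - x| by field.
apply: lerD; last first.
  apply: le_trans (hd _ _ yd) _; first by rewrite y0 yn.
  by rewrite ler_wpM2r.
have [xy|yx] := leP x y.
  apply: le_trans (Fdiff n x y _ yn) _; first by rewrite x0 xy.
  by rewrite ger0_norm ?subr_ge0 // ler_wpM2r ?subr_ge0 // lerD.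
have -> : F y - G n y - (F x - G n x) = - ((F x - G n x) - (F y - G n y)) by lmod.
rewrite normrN; apply: le_trans (Fdiff n y x _ _) _; [by rewrite y0 ltW|lra|].
have -> : `|y - x| = x - y by rewrite distrC ger0_norm // subr_ge0 ltW.
by apply: ler_wpM2r; [lra|rewrite lerD].
Qed.

End Primitives.

(** * Calculus rules for primitives *)

Section PrimitiveCalculus.
Variables (R : realType) (E : completeNormedModType R).
Implicit Types (F G phi psi : R -> E) (a c : R).

Lemma primitiveD F G phi psi : primitive F phi -> primitive G psi ->
  primitive (fun t => F t + G t) (fun t => phi t + psi t).
Proof.
move=> HF HG u u0 e e0; have e20 : 0 < e / 2 by lra.
have [d1 d10 h1] := HF u u0 _ e20; have [d2 d20 h2] := HG u u0 _ e20.
exists (Num.min d1 d2); first by rewrite lt_min d10 d20.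
move=> y y0; rewrite lt_min => /andP[y1 y2].
have -> : F y + G y - (F u + G u) - (y - u) *: (phi u + psi u) =
  (F y - F u - (y - u) *: phi u) + (G y - G u - (y - u) *: psi u) by lmod.
apply: le_trans (ler_normD _ _) _.
by have := h1 _ y0 y1; have := h2 _ y0 y2; lra.
Qed.

Lemma primitiveZ c F phi : primitive F phi ->
  primitive (fun t => c *: F t) (fun t => c *: phi t).
Proof.
move=> HF u u0 e e0.
have c0 : 0 < `|c| + 1 by have := normr_ge0 c; lra.
have [d d0 h] := HF u u0 (e / (`|c| + 1)) (divr_gt0 e0 c0).
exists d => // y y0 yd.
have -> : c *: F y - c *: F u - (y - u) *: (c *: phi u) =
  c *: (F y - F u - (y - u) *: phi u) by lmod.
rewrite normrZ; apply: le_trans (ler_wpM2l (normr_ge0 c) (h _ y0 yd)) _.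
rewrite mulrA; apply: ler_wpM2r => //.
rewrite mulrCA -[leRHS]mulr1 ler_wpM2l ?(ltW e0) // ler_pdivrMr // mul1r; lra.
Qed.

Lemma primitive_linear (L : E -> E) F phi :
  (forall x y, L (x + y) = L x + L y) -> (forall c x, L (c *: x) = c *: L x) ->
  (forall x, `|L x| <= `|x|) -> primitive F phi ->
  primitive (fun t => L (F t)) (fun t => L (phi t)).
Proof.
move=> LD LZ Lle HF u u0 e e0; have [d d0 h] := HF u u0 e e0.
exists d => // y y0 yd.
have LN x : L (- x) = - L x by rewrite -scaleN1r LZ scaleN1r.
rewrite -LZ -!LN -!LD; apply: le_trans (Lle _) _; exact: h.
Qed.

Lemma primitive_linear_fun (v : E) : primitive (fun t => t *: v) (fun=> v).
Proof.
move=> u u0 e e0; exists 1 => // y _ _.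
have -> : y *: v - u *: v - (y - u) *: v = 0 by lmod.
by rewrite normr0 mulr_ge0 // ltW.
Qed.

Lemma primitive_dilate c F phi : 0 < c -> primitive F phi ->
  primitive (fun t => c^-1 *: F (c * t)) (fun t => phi (c * t)).
Proof.
move=> c0 HF u u0 e e0.
have [|d d0 h] := HF (c * u) _ e e0; first by rewrite mulr_ge0 // ltW.
exists (d / c); first exact: divr_gt0.
move=> y y0; rewrite ltr_pdivlMr // => yd.
have nE : `|c * y - c * u| = c * `|y - u| by rewrite -mulrBr normrM gtr0_norm.
have -> : c^-1 *: F (c * y) - c^-1 *: F (c * u) - (y - u) *: phi (c * u) =
  c^-1 *: (F (c * y) - F (c * u) - (c * y - c * u) *: phi (c * u)).
  by lmod_coefs; field; rewrite lt0r_neq0.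
rewrite normrZ gtr0_norm ?invr_gt0 // ler_pdivrMl // mulrCA -nE.
by apply: h; [rewrite mulr_ge0 // ltW|rewrite nE mulrC].
Qed.

Lemma primitive_shift a F phi : 0 <= a -> primitive F phi ->
  primitive (fun t => F (a + t)) (fun t => phi (a + t)).
Proof.
move=> a0 HF u u0 e e0.
have [|d d0 h] := HF (a + u) _ e e0; first by rewrite addr_ge0.
exists d => // y y0 yd.
have yE : y - u = (a + y) - (a + u) by ring.
by rewrite yE; apply: h; rewrite -?yE // addr_ge0.
Qed.

Lemma primitive_subr v F phi : primitive F phi -> primitive (fun t => F t - v) phi.
Proof.
move=> HF u u0 e e0; have [d d0 h] := HF u u0 e e0.
exists d => // y y0 yd.
have -> : F y - v - (F u - v) - (y - u) *: phi u = F y - F u - (y - u) *: phi u by lmod.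
exact: h.
Qed.

End PrimitiveCalculus.

(** * One-sided remainders o(u) and bounds for the exponential *)

Section LittleO.
Variables (R : realType) (E : completeNormedModType R).
Implicit Types (r : R -> E) (C c : R).

(** From e^-u >= 1 - u one gets e^u <= 1/(1 - u) = 1 + u + u^2/(1 - u), and 1 - u >= 1/2. *)
Lemma expR_sub1_bounds (u : R) : 0 <= u <= 1 / 2 ->
  u <= expR u - 1 /\ expR u - 1 <= u + 2 * u ^+ 2.
Proof.
move=> /andP[u0 u2]; have := expR_ge1Dx u; have := expR_ge1Dx (- u).
rewrite expRN => h1 h2; split; first by lra.
have e0 := expR_gt0 u.
have : (1 - u) * expR u <= 1.
  by rewrite -ler_pdivlMr // mul1r.
nra.
Qed.

Lemma expR_half_le2 (u : R) : 0 <= u <= 1 / 2 -> expR u - 1 <= 2 * u.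
Proof. by move=> hu; have [_] := expR_sub1_bounds hu; move: hu; nra. Qed.

Lemma expRN_sub1_bounds (u : R) : 0 <= u ->
  u - u ^+ 2 <= 1 - expR (- u) /\ 1 - expR (- u) <= u.
Proof.
move=> u0; have := expR_ge1Dx (- u); have := expR_ge1Dx u; rewrite expRN => h1 h2.
have e0 := expR_gt0 u; split; last by lra.
have : (expR u)^-1 * (1 + u) <= 1.
  by rewrite mulrC ler_pdivrMr // mul1r.
nra.
Qed.

Definition little_o r : Prop :=
  forall e : R, 0 < e -> exists2 d : R, 0 < d & forall u : R, 0 < u < d -> `|r u| <= e * u.

Lemma little_oD r1 r2 : little_o r1 -> little_o r2 -> little_o (fun u => r1 u + r2 u).
Proof.
move=> h1 h2 e e0; have e20 : 0 < e / 2 by lra.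
have [d1 d10 {}h1] := h1 _ e20; have [d2 d20 {}h2] := h2 _ e20.
exists (Num.min d1 d2); first by rewrite lt_min d10 d20.
move=> u /andP[u0]; rewrite lt_min => /andP[u1 u2].
apply: le_trans (ler_normD _ _) _.
by have := h1 u; have := h2 u; rewrite u0 u1 u2 /=; lra.
Qed.

(** Domination is asked only for u < 1/2, the range in which the exponential bounds hold. *)
Lemma little_o_dom C r1 r2 : 0 <= C -> little_o r1 ->
  (forall u : R, 0 < u < 1 / 2 -> `|r2 u| <= C * `|r1 u|) -> little_o r2.
Proof.
move=> C0 h1 h2 e e0.
have C10 : 0 < C + 1 by lra.
have [d d0 {}h1] := h1 _ (divr_gt0 e0 C10).
exists (Num.min d (1 / 2)); first by rewrite lt_min d0 /=; lra.
move=> u /andP[u0]; rewrite lt_min => /andP[ud u2].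
apply: le_trans (h2 _ _) _; first by rewrite u0 u2.
apply: le_trans (ler_wpM2l C0 (h1 _ _)) _; first by rewrite u0 ud.
rewrite mulrA ler_wpM2r ?(ltW u0) // mulrCA -[leRHS]mulr1.
by rewrite ler_wpM2l ?(ltW e0) // ler_pdivrMr // mul1r; lra.
Qed.

Lemma little_oZ c r : little_o r -> little_o (fun u => c *: r u).
Proof. by move=> h; apply: little_o_dom (normr_ge0 c) h _ => u _; rewrite normrZ. Qed.

Lemma little_o_quadratic C r : 0 <= C ->
  (forall u : R, 0 < u < 1 / 2 -> `|r u| <= C * u ^+ 2) -> little_o r.
Proof.
move=> C0 h e e0; have C10 : 0 < C + 1 by lra.
exists (Num.min (e / (C + 1)) (1 / 2)).
  by rewrite lt_min divr_gt0 //=; lra.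
move=> u /andP[u0]; rewrite lt_min ltr_pdivlMr // => /andP[ud u2].
apply: le_trans (h _ _) _; first by rewrite u0 u2.
by rewrite expr2 mulrA ler_wpM2r ?(ltW u0) //; nra.
Qed.

(** In the applications [k u] may be 0, as when it is (e^u - 1) t with t = 0. Since [little_o] says
    nothing at 0, the value [r 0] is prescribed. *)
Lemma little_o_comp C (k : R -> R) r : 0 <= C -> r 0 = 0 -> little_o r ->
  (forall u : R, 0 < u < 1 / 2 -> 0 <= k u <= C * u) -> little_o (fun u => r (k u)).
Proof.
move=> C0 r0 hr hk e e0; have C10 : 0 < C + 1 by lra.
have [d d0 {}hr] := hr _ (divr_gt0 e0 C10).
exists (Num.min (d / (C + 1)) (1 / 2)).
  by rewrite lt_min divr_gt0 //=; lra.
move=> u /andP[u0]; rewrite lt_min ltr_pdivlMr // => /andP[ud u2].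
have /andP[k0 kC] : 0 <= k u <= C * u by apply: hk; rewrite u0 u2.
have [k0'|k0'] := ltP 0 (k u); last first.
  have -> : k u = 0 by apply/eqP; rewrite eq_le k0 k0'.
  by rewrite r0 normr0; nra.
apply: le_trans (hr _ _) _; first by rewrite k0' /=; nra.
rewrite mulrAC ler_pdivrMr // -mulrA ler_wpM2l ?(ltW e0) //; nra.
Qed.

End LittleO.

(** * Generators and Steklov averages *)

Section Representation.
Variables (R : realType) (E : completeNormedModType R) (T : R -> R -> E -> E).
Hypothesis HT : is_contr_rep_axb T.
Implicit Types (f g : E) (j : bool) (a b c e s t u x K : R).

Lemma Tj_add j t f g : Tj T j t (f + g) = Tj T j t f + Tj T j t g.
Proof. by case: HT => TD _; case: j; rewrite /Tj TD ?expR_gt0. Qed.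

Lemma Tj_scale j t c f : Tj T j t (c *: f) = c *: Tj T j t f.
Proof. by case: HT => _ [TZ _]; case: j; rewrite /Tj TZ ?expR_gt0. Qed.

Lemma Tj_opp j t f : Tj T j t (- f) = - Tj T j t f.
Proof. by rewrite -scaleN1r Tj_scale scaleN1r. Qed.

Lemma Tj_sub j t f g : Tj T j t (f - g) = Tj T j t f - Tj T j t g.
Proof. by rewrite Tj_add Tj_opp. Qed.

Lemma Tj_zero j t : Tj T j t 0 = 0.
Proof. by rewrite -(scale0r (0 : E)) Tj_scale !scale0r. Qed.

Lemma Tj_0 j f : Tj T j 0 f = f.
Proof. by case: HT => _ [_ [T1 _]]; case: j; rewrite /Tj ?expR0 T1. Qed.

Lemma Tj_norm j t f : `|Tj T j t f| <= `|f|.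
Proof.
by case: HT => _ [_ [_ [_ [_ Tn]]]]; case: j; apply: Tn; rewrite ?expR_gt0.
Qed.

Lemma Tj_addt j t u f : Tj T j (t + u) f = Tj T j t (Tj T j u f).
Proof.
case: HT => _ [_ [_ [TM _]]]; case: j; rewrite /Tj.
  by rewrite -TM // mul1r mul1r addrC.
by rewrite -TM ?expR_gt0 // mulr0 addr0 expRD.
Qed.

Lemma Tj_comm j t u f : Tj T j t (Tj T j u f) = Tj T j u (Tj T j t f).
Proof. by rewrite -!Tj_addt addrC. Qed.

(* The commutation rule [(e^u,0)(1,t) = (1,e^u t)(e^u,0)]. *)
Lemma T1_T2 u t f : Tj T false u (Tj T true t f) = Tj T true (expR u * t) (Tj T false u f).
Proof.
case: HT => _ [_ [_ [TM _]]]; rewrite /Tj -!TM ?expR_gt0 //.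
by rewrite mul1r mulr1 addr0 mulr0 add0r.
Qed.

Lemma T2_T1 u t f : Tj T true t (Tj T false u f) = Tj T false u (Tj T true (expR (- u) * t) f).
Proof. by rewrite T1_T2 mulrA -expRD subrr expR0 mul1r. Qed.

Lemma Tj_cont0 j f e : 0 < e -> exists2 d : R, 0 < d &
  forall t, `|t| < d -> `|Tj T j t f - f| <= e.
Proof.
case: HT => _ [_ [_ [_ [Tc _]]]] e0.
have {Tc} Tc := Tc f.
have oA : open [set p : R * R | 0 < p.1].
  apply: (@open_comp _ _ fst [set x : R | 0 < x]); last exact: open_gt.
  by move=> p _; exact: cvg_fst.
have A1 : [set p : R * R | 0 < p.1] (1, 0) by rewrite /= ltr01.
have {}Tc : {for (1, 0), continuous (fun p : R * R => T p.1 p.2 f)}.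
  move: Tc; rewrite continuous_open_subspace // => Tc.
  by apply: Tc; rewrite inE.
pose gam (t : R) : R * R := if j then (1, t) else (expR t, 0).
have gE t : Tj T j t f = T (gam t).1 (gam t).2 f by rewrite /gam; case: (j).
have g0 : gam 0 = (1, 0) by rewrite /gam; case: (j); rewrite ?expR0.
have cg : gam t @[t --> (0 : R)] --> ((1, 0) : R * R).
  have cid : t @[t --> (0 : R)] --> (0 : R) by exact: cvg_id.
  have ce : expR t @[t --> (0 : R)] --> (1 : R).
    by rewrite -[X in _ --> X](expR0 R); exact: continuous_expR.
  rewrite /gam; case: (j).
    exact: (cvg_pair (cvg_cst (1 : R)) cid).
  exact: (cvg_pair ce (cvg_cst (0 : R))).
have Tg : Tj T j t f @[t --> (0 : R)] --> f.
  have -> : (fun t => Tj T j t f) = (fun p : R * R => T p.1 p.2 f) \o gam.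
    by apply/funext => t; exact: gE.
  apply: cvg_comp cg _.
  by case: (HT) => _ [_ [T1 _]]; move: Tc; rewrite /prop_for /continuous_at /= T1.
move: Tg => /cvgrPdist_le /(_ _ e0) /nbhs_ballP[d d0 hd].
exists d => // t td.
have := hd t; rewrite -ball_normE /= sub0r normrN => /(_ td).
by rewrite distrC.
Qed.

Lemma Tj_cont j f : cont_nonneg (fun t => Tj T j t f).
Proof.
move=> x _ e e0; have [d d0 hd] := Tj_cont0 j f e0; exists d => // y _ yd.
have -> : y = x + (y - x) by ring.
rewrite Tj_addt -Tj_sub; apply: le_trans (Tj_norm _ _ _) _; exact: hd.
Qed.

(** The graph of the generator: membership in the domain and the value in a single relation, which
    is closed under sums and under T_j(t). [is_genP] translates it to [Adom] and [Aop]. *)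
Definition is_gen j g d : Prop := little_o (fun u => Tj T j u g - g - u *: d).

Lemma near0rP (P : R -> Prop) :
  (\forall u \near 0^'+, P u) <-> exists2 d : R, 0 < d & forall u, 0 < u < d -> P u.
Proof.
split.
  move=> /nbhs_ballP[d d0 hd]; exists d => // u /andP[u0 ud].
  by apply: hd => //; rewrite -ball_normE /= sub0r normrN gtr0_norm.
move=> [d d0 hd]; apply/nbhs_ballP; exists d => // u.
by rewrite -ball_normE /= sub0r normrN => ud u0; apply: hd; rewrite u0 -(gtr0_norm u0).
Qed.

Lemma is_gen_cvg j g d : is_gen j g d <-> (gen_quot T j g @ 0^'+ --> d).
Proof.
have qE u : 0 < u -> `|Tj T j u g - g - u *: d| = u * `|d - gen_quot T j g u|.
  move=> u0; have <- : `|u *: (d - gen_quot T j g u)| = u * `|d - gen_quot T j g u|.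
    by rewrite normrZ gtr0_norm.
  rewrite -normrN.
  by congr (`|_|); rewrite /gen_quot /=; lmod_coefs; field; rewrite lt0r_neq0.
split=> [h|/cvgrPdist_le h e e0].
  apply/cvgrPdist_le => e e0; apply/near0rP; have [a a0 ha] := h e e0.
  exists a => // u ua; have := ha u ua; case/andP: ua => u0 _.
  by rewrite qE // mulrC ler_pM2r.
have /near0rP[a a0 ha] := h e e0; exists a => // u ua.
have := ha u ua; case/andP: ua => u0 _.
by rewrite qE // [e * _]mulrC ler_pM2l.
Qed.

Lemma is_genP j g d : is_gen j g d <-> Adom T j g /\ Aop T j g = d.
Proof.
rewrite is_gen_cvg; split=> [h|[h <-]] //.
by split; [apply/cvg_ex; exists d|exact: cvg_lim].
Qed.

Lemma is_gen_Aop j g : Adom T j g -> is_gen j g (Aop T j g).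
Proof. by move=> h; apply/is_genP. Qed.

Lemma is_gen_Adom j g d : is_gen j g d -> Adom T j g.
Proof. by case/is_genP. Qed.

Lemma AopE j g d : is_gen j g d -> Aop T j g = d.
Proof. by case/is_genP. Qed.

Lemma is_genD j f g (a b : E) : is_gen j f a -> is_gen j g b -> is_gen j (f + g) (a + b).
Proof.
move=> hf hg; apply: little_o_dom ler01 (little_oD hf hg) _ => u _; rewrite mul1r Tj_add.
by rewrite le_eqVlt; apply/orP; left; apply/eqP; congr (`|_|); lmod.
Qed.

Lemma is_genZ j c f (a : E) : is_gen j f a -> is_gen j (c *: f) (c *: a).
Proof.
move=> hf; apply: little_o_dom ler01 (little_oZ c hf) _ => u _; rewrite mul1r Tj_scale.
by rewrite le_eqVlt; apply/orP; left; apply/eqP; congr (`|_|); lmod.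
Qed.

Lemma is_gen0 j : is_gen j 0 0.
Proof.
move=> e e0; exists 1 => // u /andP[u0 _].
by rewrite Tj_zero subrr scaler0 subr0 normr0 mulr_ge0 // ltW.
Qed.

Lemma is_gen_T_same j t g d : is_gen j g d -> is_gen j (Tj T j t g) (Tj T j t d).
Proof.
move=> h; apply: little_o_dom ler01 h _ => u _; rewrite mul1r Tj_comm.
by rewrite -Tj_scale -!Tj_sub Tj_norm.
Qed.

(** T_2(u) T_1(t) = T_1(t) T_2(e^-t u): the rescaled parameter produces the factor e^-t. *)
Lemma is_gen2_T1 t g d : is_gen true g d ->
  is_gen true (Tj T false t g) (Tj T false t (expR (- t) *: d)).
Proof.
move=> h.
have h' : little_o (fun u => Tj T true (expR (- t) * u) g - g - (expR (- t) * u) *: d).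
  apply: (little_o_comp (C := expR (- t)) (k := fun u => expR (- t) * u)) h _.
  - exact: expR_ge0.
  - by rewrite Tj_0 subrr scale0r subr0.
  - by move=> u /andP[u0 _]; rewrite lexx andbT mulr_ge0 ?expR_ge0 // ltW.
apply: little_o_dom ler01 h' _ => u _; rewrite mul1r T2_T1.
by rewrite -Tj_scale -!Tj_sub scalerA mulrC Tj_norm.
Qed.

Lemma is_gen1_T2 t g d1 d2 : 0 <= t -> is_gen false g d1 -> is_gen true g d2 ->
  is_gen false (Tj T true t g) (Tj T true t (d1 + t *: d2)).
Proof.
move=> t0 h1 h2; pose v u := (expR u - 1) * t.
have v0 u : 0 < u < 1 / 2 -> 0 <= v u <= 2 * t * u.
  move=> /andP[u0 u2]; have hu : 0 <= u <= 1 / 2 by lra.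
  have [h _] := expR_sub1_bounds hu; have := expR_half_le2 hu; rewrite /v; nra.
(* Here T_1(u) T_2(t) g = T_2(t) T_2(v) T_1(u) g with v = (e^u - 1) t. The four remainders replace
   T_1(u) g by g + u d1, then T_2(v) g by g + v d2, then v by u t, and finally T_2(v) d1 by d1. *)
have o1 : little_o (fun u => Tj T true (v u) (Tj T false u g - g - u *: d1)).
  by apply: little_o_dom ler01 h1 _ => u _; rewrite mul1r Tj_norm.
have o2 : little_o (fun u => Tj T true (v u) g - g - v u *: d2).
  apply: little_o_comp h2 v0; first by rewrite mulr_ge0 //; lra.
  by rewrite Tj_0 subrr scale0r subr0.
have o3 : little_o (fun u => (v u - u * t) *: d2).
  apply: (@little_o_quadratic _ _ (2 * t * `|d2|)).
    by rewrite !mulr_ge0.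
  move=> u /andP[u0 u2]; have hu : 0 <= u <= 1 / 2 by lra.
  have [ha hb] := expR_sub1_bounds hu.
  rewrite normrZ mulrAC ler_wpM2r // ger0_norm; rewrite /v; nra.
have o4 : little_o (fun u => u *: (Tj T true (v u) d1 - d1)).
  move=> e e0; have [d d0 hd] := Tj_cont0 true d1 e0.
  have t10 : 0 < 2 * t + 1 by lra.
  exists (Num.min (d / (2 * t + 1)) (1 / 2)).
    by rewrite lt_min divr_gt0 //=; lra.
  move=> u /andP[u0]; rewrite lt_min ltr_pdivlMr // => /andP[ud u2].
  rewrite normrZ gtr0_norm // mulrC ler_wpM2r ?(ltW u0) //; apply: hd.
  have /andP[va vb] : 0 <= v u <= 2 * t * u by apply: v0; rewrite u0 u2.
  by rewrite ger0_norm //; nra.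
apply: little_o_dom ler01 (little_oD (little_oD o1 o2) (little_oD o3 o4)) _ => u _; rewrite mul1r T1_T2.
have -> : expR u * t = t + v u by rewrite /v; ring.
rewrite Tj_addt -Tj_scale -!Tj_sub; apply: le_trans (Tj_norm _ _ _) _.
rewrite le_eqVlt; apply/orP; left; apply/eqP; congr (`|_|).
by rewrite !Tj_sub !Tj_scale; lmod.
Qed.

(** The integral of T_j(t) f over [0, x]. Uniqueness of primitives determines the chosen function
    only on x >= 0, hence the sign conditions in its rules. *)
Definition Tint j f : R -> E := projT1 (cid (primitive_ex (Tj_cont j f))).

Lemma Tint0 j f : Tint j f 0 = 0.
Proof. by rewrite /Tint; case: cid => F []. Qed.

Lemma Tint_primitive j f : primitive (Tint j f) (fun t => Tj T j t f).
Proof. by rewrite /Tint; case: cid => F []. Qed.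

Lemma TintE j f F x : 0 <= x -> F 0 = 0 ->
  primitive F (fun t => Tj T j t f) -> Tint j f x = F x.
Proof.
move=> x0 F0 hF; apply: primitive_unique (Tint_primitive j f) hF _ x0.
by rewrite Tint0.
Qed.

Lemma TintD j f g x : 0 <= x -> Tint j (f + g) x = Tint j f x + Tint j g x.
Proof.
move=> x0; apply: (TintE (F := fun t => Tint j f t + Tint j g t)) => //.
  by rewrite !Tint0 addr0.
have -> : (fun t => Tj T j t (f + g)) = (fun t => Tj T j t f + Tj T j t g).
  by apply/funext => t; rewrite Tj_add.
by apply: primitiveD; exact: Tint_primitive.
Qed.

Lemma TintZ j c f x : 0 <= x -> Tint j (c *: f) x = c *: Tint j f x.
Proof.
move=> x0; apply: (TintE (F := fun t => c *: Tint j f t)) => //.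
  by rewrite Tint0 scaler0.
have -> : (fun t => Tj T j t (c *: f)) = (fun t => c *: Tj T j t f).
  by apply/funext => t; rewrite Tj_scale.
by apply: primitiveZ; exact: Tint_primitive.
Qed.

Lemma Tint_Tj j t f x : 0 <= x -> Tint j (Tj T j t f) x = Tj T j t (Tint j f x).
Proof.
move=> x0; apply: (TintE (F := fun u => Tj T j t (Tint j f u))) => //.
  by rewrite Tint0 Tj_zero.
have -> : (fun u => Tj T j u (Tj T j t f)) = (fun u => Tj T j t (Tj T j u f)).
  by apply/funext => u; rewrite Tj_comm.
apply: primitive_linear (Tint_primitive j f) => *;
  [exact: Tj_add|exact: Tj_scale|exact: Tj_norm].
Qed.

Lemma Tint_shift j t f x : 0 <= t -> 0 <= x ->
  Tj T j t (Tint j f x) = Tint j f (t + x) - Tint j f t.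
Proof.
move=> t0 x0; rewrite -Tint_Tj //.
apply: (TintE (F := fun u => Tint j f (t + u) - Tint j f t)) => //.
  by rewrite addr0 subrr.
have -> : (fun u => Tj T j u (Tj T j t f)) = (fun u => Tj T j (t + u) f).
  by apply/funext => u; rewrite Tj_addt Tj_comm.
by apply/primitive_subr/(primitive_shift t0 (Tint_primitive j f)).
Qed.

(** T_1(u) moves under the integral by the commutation rule, and the substitution t -> e^u t changes
    the endpoint and gives the factor e^-u. *)
Lemma Tint_dilate u f x : 0 <= x ->
  Tj T false u (Tint true f x) =
  (expR u)^-1 *: Tint true (Tj T false u f) (expR u * x).
Proof.
move=> x0; have e0 := expR_gt0 u.
apply: (@primitive_unique _ _ (fun x => Tj T false u (Tint true f x))
  (fun x => (expR u)^-1 *: Tint true (Tj T false u f) (expR u * x))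
  (fun x => Tj T true (expR u * x) (Tj T false u f))) => //.
- have -> : (fun x => Tj T true (expR u * x) (Tj T false u f)) =
      (fun x => Tj T false u (Tj T true x f)).
    by apply/funext => y; rewrite T1_T2.
  apply: primitive_linear (Tint_primitive true f) => *;
    [exact: Tj_add|exact: Tj_scale|exact: Tj_norm].
- exact: primitive_dilate (Tint_primitive _ _).
- by rewrite mulr0 !Tint0 Tj_zero scaler0.
Qed.

Lemma Tint_seminorm p j f a b K : bounded_seminorm p -> 0 <= a <= b ->
  (forall t, a <= t <= b -> p (Tj T j t f) <= K) ->
  p (Tint j f b - Tint j f a) <= K * (b - a).
Proof.
move=> hp /andP[a0 ab] hK.
exact: primitive_mean_value (Tint_primitive j f) a0 ab hK.
Qed.

Lemma Tint_norm j f a b : 0 <= a <= b ->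
  `|Tint j f b - Tint j f a| <= `|f| * (b - a).
Proof.
move=> ab; apply: (Tint_seminorm (bounded_seminorm_norm _) ab) => t _.
exact: Tj_norm.
Qed.

Lemma Tint_right_deriv j f x : 0 <= x ->
  little_o (fun u => Tint j f (x + u) - Tint j f x - u *: Tj T j x f).
Proof.
move=> x0 e e0; have [d d0 hd] := Tint_primitive j f x0 e0.
exists d => // u /andP[u0 ud].
have xuE : x + u - x = u by ring.
have := hd (x + u); rewrite xuE !(gtr0_norm u0); apply=> //.
by rewrite addr_ge0 // ltW.
Qed.

(** T_j(u) shifts the interval of integration, so T_j(u) - I leaves the integral over [x, x+u] minus
    the one over [0, u]; each is differentiated at its left end. *)
Lemma is_gen_Tint j f x : 0 <= x -> is_gen j (Tint j f x) (Tj T j x f - f).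
Proof.
move=> x0.
have := little_oD (Tint_right_deriv j f x0)
  (little_oZ (-1) (Tint_right_deriv j f (lexx 0))).
move=> h e e0; have [d d0 hd] := h e e0; exists d => // u ud.
have /= := hd u ud; case/andP: ud => u0 _.
rewrite (Tint_shift _ _ (ltW u0) x0) Tj_0 Tint0 !add0r [x + u]addrC.
by congr (`|_| <= _); lmod.
Qed.

(** The derivative of [Tint_dilate] at u = 0: the integrand T_1(u) g gives the first term, the
    endpoint e^u x the second, the factor e^-u the third. This is the source of the commutator of
    A_1 with M_2. *)
Lemma is_gen1_Tint2 g d x : 0 <= x -> is_gen false g d ->
  is_gen false (Tint true g x)
    (Tint true d x + x *: Tj T true x g - Tint true g x).
Proof.
move=> x0 hg.
pose c (u : R) := expR u.
have cp u : 0 < c u by exact: expR_gt0.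
have cge0 u : 0 <= c u by exact: expR_ge0.
have c1 u : 0 < u < 1 / 2 -> 1 + u <= c u /\ c u <= 1 + u + 2 * u ^+ 2.
  move=> /andP[u0 u2]; have hu : 0 <= u <= 1 / 2 by lra.
  by have [] := expR_sub1_bounds hu; rewrite /c; lra.
have ci0 u : 0 < u -> 0 <= (c u)^-1 <= 1.
  move=> u0; apply/andP; split; first by rewrite invr_ge0.
  rewrite invf_le1 //; apply: le_trans (expR_ge1Dx u); lra.
have ci u : 0 < u -> u - u ^+ 2 <= 1 - (c u)^-1 /\ 1 - (c u)^-1 <= u.
  by move=> /ltW /expRN_sub1_bounds; rewrite expRN.
(* The remainders come, in order, from linearising T_1(u) g in the integrand, from the change of
   factor and endpoint in the term already multiplied by u, from the moving endpoint, and from 1 -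
   e^-u = u + O(u^2). *)
have o1 : little_o (fun u => (c u)^-1 *:
    Tint true (Tj T false u g - g - u *: d) (c u * x)).
  apply: (little_o_dom x0 hg) => u /andP[u0 u2].
  have := Tint_norm true (Tj T false u g - g - u *: d) (a := 0) (b := c u * x).
  have cx0 : 0 <= c u * x by apply: mulr_ge0; [exact: cge0|].
  rewrite lexx cx0 Tint0 !subr0 => /(_ isT) h.
  rewrite normrZ ger0_norm ?invr_ge0 ?cge0 // ler_pdivrMl ?cp //.
  by rewrite mulrA [_ * `|_|]mulrC.
have o2 : little_o (fun u => u *: ((c u)^-1 *: Tint true d (c u * x) - Tint true d x)).
  apply: (@little_o_quadratic _ _ (3 * x * `|d|)).
    by rewrite !mulr_ge0.
  move=> u /andP[u0 u2]; rewrite normrZ gtr0_norm // expr2 mulrCA ler_wpM2l ?(ltW u0) //.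
  have [ca cb] : 1 + u <= c u /\ c u <= 1 + u + 2 * u ^+ 2 by apply: c1; rewrite u0 u2.
  have [da db] := ci _ u0; have /andP[c0 c1'] := ci0 _ u0.
  have -> : (c u)^-1 *: Tint true d (c u * x) - Tint true d x =
     (c u)^-1 *: (Tint true d (c u * x) - Tint true d x) +
     ((c u)^-1 - 1) *: (Tint true d x - Tint true d 0).
    by rewrite Tint0; lmod.
  apply: le_trans (ler_normD _ _) _; rewrite !normrZ ger0_norm //.
  have xcx : 0 <= x <= c u * x by apply/andP; split => //; nra.
  have h1 := Tint_norm true d xcx.
  have x0' : (0 : R) <= 0 <= x by apply/andP; split.
  have h2 := Tint_norm true d x0'.
  have k1 : (c u)^-1 * `|Tint true d (c u * x) - Tint true d x| <= 2 * u * x * `|d|.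
    apply: le_trans (ler_piMl (normr_ge0 _) c1') _; apply: le_trans h1 _.
    rewrite mulrC ler_wpM2r //; nra.
  have k2 : `|(c u)^-1 - 1| * `|Tint true d x - Tint true d 0| <= u * x * `|d|.
    have -> : u * x * `|d| = u * (`|d| * (x - 0)) by ring.
    apply: ler_pM => //; rewrite distrC ger0_norm; lra.
  apply: le_trans (lerD k1 k2) _; rewrite le_eqVlt; apply/orP; left; apply/eqP; ring.
have o3 : little_o (fun u => (c u)^-1 *:
    (Tint true g (x + (c u - 1) * x) - Tint true g x - ((c u - 1) * x) *: Tj T true x g)).
  pose r u := Tint true g (x + u) - Tint true g x - u *: Tj T true x g.
  have h : little_o (fun u => r ((c u - 1) * x)).
    apply: (@little_o_comp _ _ (2 * x) (fun u => (c u - 1) * x) r).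
    - by rewrite mulr_ge0.
    - by rewrite /r addr0 subrr scale0r subr0.
    - exact: Tint_right_deriv.
    - move=> u /andP[u0 u2].
      have [ca cb] : 1 + u <= c u /\ c u <= 1 + u + 2 * u ^+ 2 by apply: c1; rewrite u0 u2.
      have cu2 : c u - 1 <= 2 * u by nra.
      apply/andP; split; first by apply: mulr_ge0 => //; lra.
      by have := ler_wpM2r x0 cu2; lra.
  apply: little_o_dom ler01 h _ => u /andP[u0 u2]; have /andP[c0 c1'] := ci0 _ u0.
  by rewrite normrZ ger0_norm // ler_wpM2r.
have o4 : little_o (fun u => (1 - (c u)^-1 - u) *: (x *: Tj T true x g - Tint true g x)).
  apply: (@little_o_quadratic _ _ `|x *: Tj T true x g - Tint true g x|) => //.
  move=> u /andP[u0 u2]; have [da db] := ci _ u0.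
  by rewrite normrZ mulrC ler_wpM2l // ler0_norm; lra.
apply: little_o_dom ler01 (little_oD (little_oD o1 o2) (little_oD o3 o4)) _ => u /andP[u0 u2].
rewrite mul1r le_eqVlt; apply/orP; left; apply/eqP; congr (`|_|).
have cx0 : 0 <= c u * x by apply: mulr_ge0; [exact: cge0|].
rewrite Tint_dilate // -/(c u).
rewrite -[- (u *: d)]scaleNr -[- g]scaleN1r !TintD // !TintZ //.
have -> : x + (c u - 1) * x = c u * x by ring.
by lmod_coefs; field; rewrite lt0r_neq0 // cp.
Qed.

(* The Steklov average [s^-1 \int_0^s T_j(t) f dt]. *)
Definition avg j s f : E := s^-1 *: Tint j f s.

Lemma avgD j s f g : 0 < s -> avg j s (f + g) = avg j s f + avg j s g.
Proof. by move=> /ltW s0; rewrite /avg TintD // scalerDr. Qed.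

Lemma avgZ j s c f : 0 < s -> avg j s (c *: f) = c *: avg j s f.
Proof. by move=> /ltW s0; rewrite /avg TintZ // !scalerA mulrC. Qed.

Lemma avg_Tj j s t f : 0 < s -> avg j s (Tj T j t f) = Tj T j t (avg j s f).
Proof. by move=> /ltW s0; rewrite /avg Tint_Tj // Tj_scale. Qed.

Lemma avgB j s f g : 0 < s -> avg j s (f - g) = avg j s f - avg j s g.
Proof. by move=> s0; rewrite avgD // -scaleN1r avgZ // scaleN1r. Qed.

Lemma avg_seminorm p j s f K : bounded_seminorm p -> 0 < s ->
  (forall t, 0 <= t <= s -> p (Tj T j t f) <= K) -> p (avg j s f) <= K.
Proof.
move=> hp s0 hK; rewrite /avg (bsnZ hp) gtr0_norm ?invr_gt0 // ler_pdivrMl //.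
have s00 : (0 : R) <= 0 <= s by apply/andP; split => //; exact: ltW.
by have := Tint_seminorm hp s00 hK; rewrite Tint0 !subr0 mulrC.
Qed.

Lemma avg_sub_seminorm p j s f K : bounded_seminorm p -> 0 < s ->
  (forall t, 0 <= t <= s -> p (Tj T j t f - f) <= K) -> p (avg j s f - f) <= K.
Proof.
move=> hp s0 hK.
have hF : primitive (fun t => Tint j f t + t *: (- f)) (fun t => Tj T j t f - f).
  exact: primitiveD (Tint_primitive j f) (primitive_linear_fun _).
have := primitive_mean_value hp hF (lexx 0) (ltW s0) hK.
rewrite Tint0 scale0r addr0 !subr0.
have -> : avg j s f - f = s^-1 *: (Tint j f s + s *: - f).
  by rewrite /avg; lmod_coefs; field; rewrite lt0r_neq0.
by rewrite (bsnZ hp) gtr0_norm ?invr_gt0 // ler_pdivrMl // mulrC.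
Qed.

Lemma is_gen_avg j s f : 0 < s -> is_gen j (avg j s f) (s^-1 *: (Tj T j s f - f)).
Proof. by move=> /ltW s0; apply/is_genZ/is_gen_Tint. Qed.

Lemma is_gen1_avg2 s g d : 0 < s -> is_gen false g d ->
  is_gen false (avg true s g) (avg true s d + Tj T true s g - avg true s g).
Proof.
move=> s0 hg; have := is_genZ s^-1 (is_gen1_Tint2 (ltW s0) hg).
congr (is_gen _ _ _); rewrite /avg.
by lmod_coefs; field; rewrite lt0r_neq0.
Qed.

Lemma orbit_primitive j g d : is_gen j g d ->
  primitive (fun t => Tj T j t g) (fun t => Tj T j t d).
Proof.
move=> hg x x0 e e0.
have e20 : 0 < e / 2 by lra.
have [a a0 ha] := hg _ e20; have [b b0 hb] := Tj_cont0 j d e20.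
exists (Num.min a b); first by rewrite lt_min a0 b0.
move=> y _; rewrite lt_min => /andP[ya yb].
have [xy|xy|->] := ltgtP x y; last first.
- by rewrite !subrr scale0r subr0 !normr0 mulr0.
(* The generator is only a right derivative. To the left of [x] the common factor T_j(y) is taken
   out, and strong continuity compares T_j(v) d with d. *)
- pose v := x - y; have v0 : 0 < v by rewrite subr_gt0.
  have yx : `|y - x| = v by rewrite distrC gtr0_norm // subr_gt0.
  have xE : x = y + v by rewrite /v; ring.
  have -> : Tj T j y g - Tj T j x g - (y - x) *: Tj T j x d =
      Tj T j y (g - Tj T j v g + v *: Tj T j v d).
    rewrite Tj_add Tj_sub Tj_scale -!Tj_addt -xE; congr (_ + _).
    by rewrite -scaleNr /v opprB.
  apply: le_trans (Tj_norm _ _ _) _.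
  have -> : g - Tj T j v g + v *: Tj T j v d =
    v *: (Tj T j v d - d) - (Tj T j v g - g - v *: d) by lmod.
  apply: le_trans (ler_normB _ _) _; rewrite normrZ gtr0_norm // yx.
  rewrite yx in ya yb.
  have hv : `|Tj T j v g - g - v *: d| <= e / 2 * v by apply: ha; rewrite v0 ya.
  have hw : `|Tj T j v d - d| <= e / 2 by apply: hb; rewrite gtr0_norm.
  have h := ler_wpM2l (ltW v0) hw.
  by apply: le_trans (lerD h hv) _; lra.
have xyE : `|y - x| = y - x by rewrite gtr0_norm // subr_gt0.
have yE : y = x + (y - x) by ring.
have -> : Tj T j y g - Tj T j x g - (y - x) *: Tj T j x d =
    Tj T j x (Tj T j (y - x) g - g - (y - x) *: d).
  by rewrite !Tj_sub Tj_scale -Tj_addt -yE.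
apply: le_trans (Tj_norm _ _ _) _; rewrite xyE in ya *.
have := ha (y - x); rewrite subr_gt0 xy ya => /(_ isT) h; apply: le_trans h _.
by apply: ler_wpM2r; lra.
Qed.

Lemma Tj_sub_Tint j g d t : is_gen j g d -> 0 <= t -> Tj T j t g - g = Tint j d t.
Proof.
move=> hg t0; rewrite (TintE (F := fun t => Tj T j t g - g)) //.
  by rewrite Tj_0 subrr.
exact/primitive_subr/orbit_primitive.
Qed.

Lemma Tj_sub_norm_gen j g d t : is_gen j g d -> 0 <= t ->
  `|Tj T j t g - g| <= t * `|d|.
Proof.
move=> hg t0; rewrite (Tj_sub_Tint hg) //.
have t00 : (0 : R) <= 0 <= t by apply/andP; split.
by have := Tint_norm j d t00; rewrite Tint0 !subr0 mulrC.
Qed.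

(** The quotient (T_j(u) g - g)/u is the average of T_j(t) d over [0, u], which differs from d by at
    most u |d'|. *)
Lemma landau_kolmogorov j g d d' u : is_gen j g d -> is_gen j d d' -> 0 < u ->
  `|d| <= u * `|d'| + 2 / u * `|g|.
Proof.
move=> hg hd u0.
have h : `|avg j u d - d| <= u * `|d'|.
  apply: (avg_sub_seminorm (bounded_seminorm_norm _) u0) => t /andP[t0 tu].
  by apply: le_trans (Tj_sub_norm_gen hd t0) _; rewrite ler_wpM2r.
have -> : d = u^-1 *: (Tj T j u g - g) - (avg j u d - d).
  by rewrite (Tj_sub_Tint hg (ltW u0)) /avg; lmod.
apply: le_trans (ler_normB _ _) _; rewrite addrC lerD //.
  have -> : 2 / u * `|g| = u^-1 * (2 * `|g|) by ring.
  rewrite normrZ gtr0_norm ?invr_gt0 // ler_pM2l ?invr_gt0 //.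
  apply: le_trans (ler_normB _ _) _; have := Tj_norm j u g; lra.
Qed.

(** * The spaces E^r *)

(** Peels off the generator applied first, while [wdom] peels off the one applied last. This form
    suits inductions in which [g] varies; [inEr_smooth] shows that both describe E^m. *)
Fixpoint smooth (m : nat) g : Prop :=
  match m with
  | 0 => True
  | m'.+1 => forall j, Adom T j g /\ smooth m' (Aop T j g)
  end.

(** With the norm for [p] this is the norm of E^m ([normEr_sobn]). The case [p = qsn s k] counts
    derivatives and differences at once. *)
Fixpoint sob (p : E -> R) (m : nat) g : R :=
  match m with
  | 0 => p g
  | m'.+1 => p g + (sob p m' (Aop T false g) + sob p m' (Aop T true g))
  end.

Lemma smooth_gen m j g : smooth m.+1 g -> is_gen j g (Aop T j g).
Proof. by move=> /(_ j)[/is_gen_Aop]. Qed.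

Lemma smooth_Aop m j g : smooth m.+1 g -> smooth m (Aop T j g).
Proof. by move=> /(_ j)[]. Qed.

Lemma smooth_intro m g (d : bool -> E) :
  (forall j, is_gen j g (d j)) -> (forall j, smooth m (d j)) -> smooth m.+1 g.
Proof. by move=> hg hd j; split; [exact: is_gen_Adom (hg j)|rewrite (AopE (hg j)); exact: hd]. Qed.

Lemma smooth_leS m g : smooth m.+1 g -> smooth m g.
Proof.
elim: m g => [//|m IH] g hg j; have [h1 h2] := hg j; split=> //.
exact: IH.
Qed.

Lemma smooth0 m : smooth m 0.
Proof.
by elim: m => // m IH j; split; [exact: is_gen_Adom (is_gen0 j)|rewrite (AopE (is_gen0 j))].
Qed.

Lemma AopD m j f g : smooth m.+1 f -> smooth m.+1 g ->
  Aop T j (f + g) = Aop T j f + Aop T j g.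
Proof. by move=> hf hg; apply/AopE/is_genD; apply: smooth_gen; eassumption. Qed.

Lemma AopZ m j c f : smooth m.+1 f -> Aop T j (c *: f) = c *: Aop T j f.
Proof. by move=> hf; apply/AopE/is_genZ; apply: smooth_gen; eassumption. Qed.

Lemma smoothD m f g : smooth m f -> smooth m g -> smooth m (f + g).
Proof.
elim: m f g => [//|m IH] f g hf hg.
apply: (smooth_intro (d := fun j => Aop T j f + Aop T j g)) => j.
  by apply: is_genD; apply: smooth_gen; eassumption.
by apply: IH; apply: smooth_Aop.
Qed.

Lemma smoothZ m c f : smooth m f -> smooth m (c *: f).
Proof.
elim: m f => [//|m IH] f hf.
apply: (smooth_intro (d := fun j => c *: Aop T j f)) => j.
  by apply: is_genZ; apply: smooth_gen; eassumption.
by apply: IH; apply: smooth_Aop.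
Qed.

Lemma smoothB m f g : smooth m f -> smooth m g -> smooth m (f - g).
Proof. by move=> hf hg; rewrite -scaleN1r; apply: smoothD => //; apply: smoothZ. Qed.

Section SobolevSeminorm.
Variables (p : E -> R) (hp : bounded_seminorm p).

Lemma sob_ge0 m g : 0 <= sob p m g.
Proof. by elim: m g => [|m IH] g /=; rewrite ?addr_ge0 // (bsn_ge0 hp). Qed.

Lemma sob_ge m g : p g <= sob p m g.
Proof. by case: m => //= m; rewrite lerDl addr_ge0 // sob_ge0. Qed.

Lemma sob_leS m g : sob p m g <= sob p m.+1 g.
Proof.
elim: m g => [|m IH] g; first exact: sob_ge.
by rewrite [leLHS]/= [leRHS]/= lerD2l lerD // IH.
Qed.

Lemma sob_Aop m j g : sob p m (Aop T j g) <= sob p m.+1 g.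
Proof.
have := bsn_ge0 hp g; have := sob_ge0 m (Aop T false g).
by have := sob_ge0 m (Aop T true g); case: j => /=; lra.
Qed.

Lemma sobD m f g : smooth m f -> smooth m g -> sob p m (f + g) <= sob p m f + sob p m g.
Proof.
elim: m f g => [|m IH] f g hf hg /=; first exact: bsn_leD.
rewrite !(AopD _ hf hg).
have := IH _ _ (smooth_Aop false hf) (smooth_Aop false hg).
have := IH _ _ (smooth_Aop true hf) (smooth_Aop true hg).
by have := bsn_leD hp f g; lra.
Qed.

Lemma sobZ m c f : smooth m f -> sob p m (c *: f) = `|c| * sob p m f.
Proof.
elim: m f => [|m IH] f hf /=; first exact: bsnZ.
by rewrite !(AopZ _ _ hf) !IH ?(bsnZ hp); [ring|exact: smooth_Aop..].
Qed.

Lemma sobB m f g : smooth m f -> smooth m g -> sob p m (f - g) <= sob p m f + sob p m g.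
Proof.
move=> hf hg; rewrite -scaleN1r; apply: le_trans (sobD hf (smoothZ _ hg)) _.
by rewrite sobZ // normrN1 mul1r.
Qed.

End SobolevSeminorm.

Lemma sob_mono p p' m g : (forall f, p f <= p' f) -> sob p m g <= sob p' m g.
Proof. by move=> pp; elim: m g => [|m IH] g //=; rewrite !lerD. Qed.

(* [A_i T_j(t) = T_j(t) (A_i + comm_coef i j t A_2)]. *)
Definition comm_coef i j t : R :=
  if i then (if j then 0 else expR (- t) - 1) else (if j then t else 0).

Lemma comm_coef_le i j t : 0 <= t -> `|comm_coef i j t| <= t.
Proof.
move=> t0; rewrite /comm_coef; case: i; case: j; rewrite ?normr0 ?(ger0_norm t0) //.
have [_ h] := expRN_sub1_bounds t0.
have h1 : expR (- t) <= 1 by rewrite -[leRHS](expR0 R) ler_expR oppr_le0.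
by rewrite ler0_norm; lra.
Qed.

Lemma is_gen_Tj i j t g : 0 <= t -> (forall k, Adom T k g) ->
  is_gen i (Tj T j t g) (Tj T j t (Aop T i g + comm_coef i j t *: Aop T true g)).
Proof.
move=> t0 hg; have h1 := is_gen_Aop (hg false); have h2 := is_gen_Aop (hg true).
rewrite /comm_coef; case: i; case: j.
- by rewrite scale0r addr0; exact: is_gen_T_same.
- have := is_gen2_T1 t h2; congr (is_gen _ _ (Tj T _ _ _)); lmod.
- exact: is_gen1_T2.
- by rewrite scale0r addr0; exact: is_gen_T_same.
Qed.

Lemma smooth_Tj m j t g : 0 <= t -> smooth m g -> smooth m (Tj T j t g).
Proof.
move=> t0; elim: m g => [//|m IH] g hg.
apply: (smooth_intro
  (d := fun i => Tj T j t (Aop T i g + comm_coef i j t *: Aop T true g))) => i.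
  by apply: is_gen_Tj => // k; case: (hg k).
apply: IH; apply: smoothD; first exact: smooth_Aop.
by apply/smoothZ/smooth_Aop.
Qed.

Lemma Aop_Tj m i j t g : 0 <= t -> smooth m.+1 g ->
  Aop T i (Tj T j t g) = Tj T j t (Aop T i g + comm_coef i j t *: Aop T true g).
Proof. by move=> t0 hg; apply/AopE/is_gen_Tj => // k; case: (hg k). Qed.

Lemma exp3_ge1 (m : nat) : 1 <= 3 ^+ m :> R.
Proof. by apply: exprn_ege1; lra. Qed.

(** The factor 3 per order: for i = 1 one meets A_1 g and A_2 g, for i = 2 twice A_2 g, so A_2 g
    occurs three times. *)
Lemma sob_Tj p j t C m g : bounded_seminorm p -> 0 <= t <= 1 -> 0 <= C ->
  (forall f, p (Tj T j t f) <= C * p f) -> smooth m g ->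
  sob p m (Tj T j t g) <= C * 3 ^+ m * sob p m g.
Proof.
move=> hp /andP[t0 t1] C0 hC; elim: m g => [|m IH] g hg.
  by rewrite /= expr0 mulr1.
have key i : sob p m (Aop T i (Tj T j t g)) <=
    C * 3 ^+ m * (sob p m (Aop T i g) + sob p m (Aop T true g)).
  have hi := smooth_Aop i hg; have h2 := smooth_Aop true hg.
  rewrite (Aop_Tj _ _ t0 hg); apply: le_trans (IH _ _) _.
    by apply: smoothD => //; exact: smoothZ.
  apply: ler_wpM2l; first by rewrite mulr_ge0 // exprn_ge0.
  apply: le_trans (sobD hp hi (smoothZ _ h2)) _; rewrite lerD2l sobZ //.
  apply: ler_piMl; first exact: sob_ge0.
  exact: le_trans (comm_coef_le _ _ t0) t1.
have := key false; have := key true; have := hC g; have := bsn_ge0 hp g.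
have := exp3_ge1 m; have := sob_ge0 hp m (Aop T false g).
have := sob_ge0 hp m (Aop T true g).
rewrite /= exprS; set a := sob _ _ _; set b := sob _ _ _; set q := 3 ^+ m.
move=> a0 b0 q1 pg0 hpg ka kb.
have Cp : C * p g <= C * (3 * q) * p g.
  rewrite -mulrA; apply: ler_wpM2l => //; nra.
have Cb : 0 <= C * q * b by rewrite !mulr_ge0 //; lra.
lra.
Qed.

(** Meant for [p = qsn s k] and [p' = qsn s k.+1]. A commutator term contains no difference, but its
    coefficient is at most s, so it obeys the same bound through [p <= p']. *)
Lemma sob_Tj_sub p p' j t s C m g : bounded_seminorm p -> bounded_seminorm p' ->
  0 <= t <= s -> s <= 1 -> 1 <= C ->
  (forall f, p (Tj T j t f) <= C * p f) ->
  (forall f, p (Tj T j t f - f) <= C * s * p' f) ->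
  (forall f, p f <= p' f) -> smooth m g ->
  sob p m (Tj T j t g - g) <= C * 3 ^+ m * s * sob p' m g.
Proof.
move=> hp hp' /andP[t0 ts] s1 C1 hC hCs pp; elim: m g => [|m IH] g hg.
  by rewrite /= expr0 mulr1.
have t1 : 0 <= t <= 1 by lra.
have C0 : 0 <= C by lra.
have s0 : 0 <= s by lra.
have key i : sob p m (Aop T i (Tj T j t g - g)) <=
    C * 3 ^+ m * s * (sob p' m (Aop T i g) + sob p' m (Aop T true g)).
  have hi := smooth_Aop i hg; have h2 := smooth_Aop true hg.
  have -> : Aop T i (Tj T j t g - g) = (Tj T j t (Aop T i g) - Aop T i g) +
      comm_coef i j t *: Tj T j t (Aop T true g).
    have gE : Tj T j t g - g = Tj T j t g + (-1) *: g by rewrite scaleN1r.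
    rewrite gE (AopD _ (smooth_Tj j t0 hg) (smoothZ _ hg)) (AopZ _ _ hg).
    by rewrite (Aop_Tj _ _ t0 hg) Tj_add Tj_scale; lmod.
  have st2 := smooth_Tj j t0 h2; have sti := smooth_Tj j t0 hi.
  apply: le_trans (sobD hp (smoothB sti hi) (smoothZ _ st2)) _.
  rewrite mulrDr lerD // ?IH // sobZ //.
  have h := sob_Tj hp t1 C0 hC h2; have := comm_coef_le i j t0 => hc.
  have h' := sob_mono m (Aop T true g) pp.
  have q0 : 0 <= C * 3 ^+ m by rewrite mulr_ge0 // exprn_ge0.
  have {}h := le_trans h (ler_wpM2l q0 h').
  have {}hc := le_trans hc ts.
  apply: le_trans (ler_pM (normr_ge0 _) (sob_ge0 hp _ _) hc h) _.
  by rewrite le_eqVlt; apply/orP; left; apply/eqP; ring.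
have := key false; have := key true; have := hCs g; have := bsn_ge0 hp' g.
have := exp3_ge1 m; have := sob_ge0 hp' m (Aop T false g).
have := sob_ge0 hp' m (Aop T true g).
rewrite /= exprS; set a := sob _ _ _; set b := sob _ _ _; set q := 3 ^+ m.
move=> a0 b0 q1 pg0 hpg ka kb.
have Cs0 : 0 <= C * s by rewrite mulr_ge0.
have Cp : C * s * p' g <= C * (3 * q) * s * p' g.
  have -> : C * (3 * q) * s * p' g = C * s * (3 * q * p' g) by ring.
  apply: ler_wpM2l => //; nra.
have Cb : 0 <= C * q * s * b by rewrite !mulr_ge0 //; lra.
lra.
Qed.

Notation sobn := (sob (fun v => `|v|)).

(** The difference is worth a factor t and a derivative; commutator terms already carry t. The base
    is 4 because the bound t |A_j g| of the zero order term joins the three occurrences of A_2 g. *)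
Lemma sobn_Tj_sub j t m g : 0 <= t <= 1 -> smooth m.+1 g ->
  sobn m (Tj T j t g - g) <= 4 ^+ m * t * sobn m.+1 g.
Proof.
have hn := bounded_seminorm_norm E.
move=> t1; have /andP[t0 _] := t1; elim: m g => [|m IH] g hg.
  rewrite expr0 mul1r; apply: le_trans (Tj_sub_norm_gen (smooth_gen j hg) t0) _.
  by rewrite ler_wpM2l //; exact: (sob_Aop hn 0 j g).
have key i : sobn m (Aop T i (Tj T j t g - g)) <=
    4 ^+ m * t * (sobn m.+1 (Aop T i g) + sobn m.+1 (Aop T true g)).
  have hi := smooth_Aop i hg; have h2 := smooth_Aop true hg.
  have -> : Aop T i (Tj T j t g - g) = (Tj T j t (Aop T i g) - Aop T i g) +
      comm_coef i j t *: Tj T j t (Aop T true g).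
    have gE : Tj T j t g - g = Tj T j t g + (-1) *: g by rewrite scaleN1r.
    rewrite gE (AopD _ (smooth_Tj j t0 hg) (smoothZ _ hg)) (AopZ _ _ hg).
    by rewrite (Aop_Tj _ _ t0 hg) Tj_add Tj_scale; lmod.
  have st2 := smooth_leS (smooth_Tj j t0 h2).
  have sti := smooth_leS (smooth_Tj j t0 hi).
  apply: le_trans (sobD hn (smoothB sti (smooth_leS hi)) (smoothZ _ st2)) _.
  rewrite mulrDr lerD // ?IH // sobZ //.
  have hC f : `|Tj T j t f| <= 1 * `|f| by rewrite mul1r Tj_norm.
  have h := sob_Tj hn t1 ler01 hC (smooth_leS h2); rewrite mul1r in h.
  have h34 : 3 ^+ m <= 4 ^+ m :> R by apply: lerXn2r; rewrite ?nnegrE //; lra.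
  have {}h := le_trans h (ler_wpM2r (sob_ge0 hn _ _) h34).
  have hc := comm_coef_le i j t0.
  have q0 : 0 <= 4 ^+ m :> R by rewrite exprn_ge0.
  have {}h := le_trans h (ler_wpM2l q0 (sob_leS hn _ _)).
  apply: le_trans (ler_pM (normr_ge0 _) (sob_ge0 hn _ _) hc h) _.
  by rewrite le_eqVlt; apply/orP; left; apply/eqP; ring.
have := key false; have := key true.
have := Tj_sub_norm_gen (smooth_gen j hg) t0.
have := normr_ge0 g; have : 1 <= 4 ^+ m :> R by apply: exprn_ege1; lra.
have := sob_ge0 hn m.+1 (Aop T false g).
have := sob_ge0 hn m.+1 (Aop T true g).
have : `|Aop T j g| <= sobn m.+1 (Aop T false g) + sobn m.+1 (Aop T true g).
  apply: le_trans (sob_ge hn m.+1 _) _.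
  have hb := sob_ge0 hn m.+1 (Aop T false g); have ha := sob_ge0 hn m.+1 (Aop T true g).
  by case: (j); lra.
rewrite exprS.
have -> : sobn m.+2 g = `|g| + (sobn m.+1 (Aop T false g) + sobn m.+1 (Aop T true g)) by [].
have -> : sobn m.+1 (Tj T j t g - g) = `|Tj T j t g - g| +
  (sobn m (Aop T false (Tj T j t g - g)) + sobn m (Aop T true (Tj T j t g - g))) by [].
set a := sobn m.+1 _; set b := sobn m.+1 _; set q := 4 ^+ m.
move=> hA b0 a0 q1 g0 h1 kb ka.
have k1 : t * `|Aop T j g| <= q * t * (a + b).
  rewrite [q * t]mulrC -mulrA; apply: ler_wpM2l => //; apply: le_trans hA _; nra.
have k2 : 0 <= q * t * `|g| by rewrite !mulr_ge0 //; lra.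
have k3 : 0 <= q * t * a by rewrite !mulr_ge0 //; lra.
lra.
Qed.

Lemma sobn_interpolation m e : 0 < e -> exists2 C, 0 <= C &
  forall g, smooth m.+1 g -> sobn m g <= e * sobn m.+1 g + C * `|g|.
Proof.
have hn := bounded_seminorm_norm E.
elim: m e => [|m IH] e e0.
  exists 1 => // g _; rewrite mul1r [sobn 0 g]/= lerDr mulr_ge0 ?(ltW e0) //.
  exact: (sob_ge0 hn 1).
have e20 : 0 < e / 2 by lra.
have [C C0 hC] := IH _ e20.
have C10 : 0 < C + 1 by lra.
(* The induction hypothesis leaves C |A_j g|. Interpolating it between A_j A_j g and g with this
   step gives the second derivative a coefficient C u <= e/2. *)
pose u := e / 2 / (C + 1).
have u0 : 0 < u by rewrite divr_gt0.
have Cu : C * u <= e / 2.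
  rewrite /u mulrA ler_pdivrMr //; nra.
exists (1 + 2 * C * (2 / u)).
  by rewrite addr_ge0 // !mulr_ge0 // invr_ge0 ltW.
move=> g hg.
have key j : sobn m (Aop T j g) <= e * sobn m.+1 (Aop T j g) + C * (2 / u) * `|g|.
  have hj := smooth_Aop j hg; apply: le_trans (hC _ hj) _.
  have h := landau_kolmogorov (smooth_gen j hg) (smooth_gen j hj) u0.
  have h2 : `|Aop T j (Aop T j g)| <= sobn m.+1 (Aop T j g).
    apply: le_trans (sob_ge hn m _) _; exact: sob_Aop.
  have h3 := ler_wpM2l C0 (le_trans h (lerD (ler_wpM2l (ltW u0) h2) (lexx _))).
  have h4 := ler_wpM2r (sob_ge0 hn m.+1 (Aop T j g)) Cu.
  lra.
have -> : sobn m.+2 g = `|g| + (sobn m.+1 (Aop T false g) + sobn m.+1 (Aop T true g)) by [].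
have -> : sobn m.+1 g = `|g| + (sobn m (Aop T false g) + sobn m (Aop T true g)) by [].
have := key false; have := key true; have := mulr_ge0 (ltW e0) (normr_ge0 g); lra.
Qed.

(** * Difference seminorms *)

Definition steps s (k : nat) (l : seq (bool * R)) : Prop :=
  size l = k /\ all (fun q => 0 <= q.2 <= s) l.

(* Equivalent to [Omega], with one supremum over all words and steps. *)
Definition dsn s (k : nat) f : R :=
  sup [set x : R | exists l, steps s k l /\ x = `|dapp T l f|].

Lemma dapp_rcons l q f : dapp T (rcons l q) f = dapp T l (Tj T q.1 q.2 f - f).
Proof. by rewrite /dapp foldr_rcons. Qed.

Lemma dappD l f g : dapp T l (f + g) = dapp T l f + dapp T l g.
Proof. by elim: l => //= q l ->; rewrite Tj_add; lmod. Qed.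

Lemma dappZ l c f : dapp T l (c *: f) = c *: dapp T l f.
Proof. by elim: l => //= q l ->; rewrite Tj_scale; lmod. Qed.

Lemma dapp_norm l f : `|dapp T l f| <= 2 ^+ size l * `|f|.
Proof.
elim: l => [|q l IH] /=; first by rewrite expr0 mul1r.
apply: le_trans (ler_normB _ _) _; rewrite exprS.
by have := Tj_norm q.1 q.2 (dapp T l f); lra.
Qed.

Lemma dsn_ge s k l f : steps s k l -> `|dapp T l f| <= dsn s k f.
Proof.
move=> hl; apply: ub_le_sup; last by exists l.
exists (2 ^+ k * `|f|) => _ [l' [[<- _] ->]]; exact: dapp_norm.
Qed.

Lemma steps_ex s k : 0 <= s -> exists l, steps s k l.
Proof.
move=> s0; exists (nseq k (true, 0)); split; first by rewrite size_nseq.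
by rewrite all_nseq /= lexx s0 orbT.
Qed.

Lemma dsn_le s k f c : 0 <= s ->
  (forall l, steps s k l -> `|dapp T l f| <= c) -> dsn s k f <= c.
Proof.
move=> s0 hc; apply: ge_sup; last by move=> _ [l [hl ->]]; exact: hc.
by have [l hl] := steps_ex k s0; exists `|dapp T l f|, l.
Qed.

Lemma dsn_le_norm s k f : 0 <= s -> dsn s k f <= 2 ^+ k * `|f|.
Proof. by move=> s0; apply: dsn_le => // l [<- _]; exact: dapp_norm. Qed.

Lemma dsn_bsn s k : 0 <= s -> bounded_seminorm (dsn s k).
Proof.
move=> s0; split.
- move=> f g; apply: dsn_le => // l hl; rewrite dappD.
  by apply: le_trans (ler_normD _ _) _; rewrite lerD // dsn_ge.
- have le_ c f : dsn s k (c *: f) <= `|c| * dsn s k f.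
    by apply: dsn_le => // l hl; rewrite dappZ normrZ ler_wpM2l // dsn_ge.
  move=> c f; apply/eqP; rewrite eq_le le_ /=.
  have [->|c0] := eqVneq c 0.
    rewrite normr0 mul0r; have [l hl] := steps_ex k s0.
    exact: le_trans (normr_ge0 _) (dsn_ge _ hl).
  rewrite -ler_pdivlMl ?normr_gt0 // -normfV.
  by have := le_ c^-1 (c *: f); rewrite scalerA mulVf // scale1r.
- by exists (2 ^+ k); [exact: exprn_ge0|move=> f; exact: dsn_le_norm].
Qed.

Lemma dsn_ge0 s k f : 0 <= s -> 0 <= dsn s k f.
Proof. by move=> s0; apply: bsn_ge0; exact: dsn_bsn. Qed.

Lemma dsn0E s f : 0 <= s -> dsn s 0 f = `|f|.
Proof.
move=> s0; apply/eqP; rewrite eq_le; apply/andP; split.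
  by have := dsn_le_norm 0 f s0; rewrite expr0 mul1r.
exact: (@dsn_ge s 0 [::]).
Qed.

Lemma dsn_Tj_sub s k j t f : 0 <= t <= s -> dsn s k (Tj T j t f - f) <= dsn s k.+1 f.
Proof.
move=> /andP[t0 ts]; apply: dsn_le; first exact: le_trans ts.
move=> l [lk hl]; have := dapp_rcons l (j, t) f => /= <-.
by apply: dsn_ge; split; [rewrite size_rcons lk|rewrite all_rcons /= t0 ts].
Qed.

Lemma dsnS_le s k f c : 0 <= s ->
  (forall j t, 0 <= t <= s -> dsn s k (Tj T j t f - f) <= c) -> dsn s k.+1 f <= c.
Proof.
move=> s0 hc; apply: dsn_le => // l; case/lastP: l => [[]//|l q].
rewrite /steps size_rcons all_rcons => -[[lk] /andP[hq hl]].
by rewrite dapp_rcons; apply: le_trans (hc q.1 q.2 hq); exact: dsn_ge.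
Qed.

(** T_j(t) is carried to the left of the innermost difference, and the induction hypothesis removes
    it there. *)
Lemma dsn_Tj k : exists2 C, 1 <= C & forall s, 0 < s <= 1 / 2 ->
  forall j t f, 0 <= t <= s -> dsn s k (Tj T j t f) <= C * dsn s k f.
Proof.
elim: k => [|k [C C1 hC]].
  exists 1 => // s /andP[s0 _] j t f _.
  by rewrite !dsn0E ?(ltW s0) // mul1r Tj_norm.
exists (C * C + C); first nra.
move=> s hs j t f hts; have /andP[s0 s2] := hs; have /andP[t0 ts] := hts.
have sge0 := ltW s0; have hk := dsn_bsn k sge0.
have d0 := dsn_ge0 k.+1 f sge0.
have CC : C * dsn s k.+1 f <= (C * C + C) * dsn s k.+1 f by nra.
apply: dsnS_le => // i u hus; have /andP[u0 us] := hus.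
have same : i = j -> dsn s k (Tj T i u (Tj T j t f) - Tj T j t f) <=
    (C * C + C) * dsn s k.+1 f.
  move=> ->; rewrite Tj_comm -Tj_sub; apply: le_trans (hC _ hs _ _ _ hts) _.
  apply: le_trans CC; apply: ler_wpM2l; [lra|exact: dsn_Tj_sub].
case: i j same => [] [] same; try exact: same.
  (* Passing T_2(u) through T_1(t) shrinks the step to e^-t u, still in [0, s]. *)
  rewrite T2_T1 -Tj_sub; apply: le_trans (hC _ hs _ _ _ hts) _.
  apply: le_trans CC; apply: ler_wpM2l; [lra|apply: dsn_Tj_sub].
  have h1 : expR (- t) <= 1 by rewrite -[leRHS](expR0 R) ler_expR oppr_le0.
  rewrite mulr_ge0 ?expR_ge0 //=; apply: le_trans us.
  by rewrite ler_piMl.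
(* Passing T_1(u) through T_2(t) gives T_2(e^u t) = T_2(t) T_2(v). Since u <= 1/2, e^u - 1 <= 2 u <=
   1 and so v <= t <= s. The piece with both T_2(t) and T_2(v) in front costs C * C, the other one
   C. *)
pose v := (expR u - 1) * t.
have hu : 0 <= u <= 1 / 2 by lra.
have [h1 _] := expR_sub1_bounds hu; have h2 := expR_half_le2 hu.
have hv : 0 <= v <= s.
  apply/andP; split; first by apply: mulr_ge0; lra.
  by apply: le_trans ts; rewrite ler_piMl //; lra.
have -> : Tj T false u (Tj T true t f) - Tj T true t f =
   Tj T true t (Tj T true v (Tj T false u f - f)) +
   Tj T true t (Tj T true v f - f).
  rewrite T1_T2; have -> : expR u * t = t + v by rewrite /v; ring.
  by rewrite Tj_addt !Tj_sub; lmod.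
apply: le_trans (bsn_leD hk _ _) _; rewrite mulrDl lerD //.
  apply: le_trans (hC _ hs _ _ _ hts) _; rewrite -mulrA ler_wpM2l //; first lra.
  apply: le_trans (hC _ hs _ _ _ hv) _; rewrite ler_wpM2l //; first lra.
  exact: dsn_Tj_sub.
apply: le_trans (hC _ hs _ _ _ hts) _; rewrite ler_wpM2l //; first lra.
exact: dsn_Tj_sub.
Qed.

Lemma dsn_smooth k : exists2 C, 0 <= C & forall s f, 0 <= s <= 1 -> smooth k f ->
  dsn s k f <= C * s ^+ k * sobn k f.
Proof.
elim: k => [|k [C C0 hC]].
  by exists 1 => // s f /andP[s0 _] _; rewrite dsn0E // expr0 !mul1r.
exists (C * 4 ^+ k); first by rewrite mulr_ge0 // exprn_ge0.
move=> s f hs hf; have /andP[s0 s1] := hs.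
apply: dsnS_le => // j t /andP[t0 ts].
have t1 : 0 <= t <= 1 by lra.
have hTf := smoothB (smooth_Tj j t0 hf) hf.
apply: le_trans (hC _ _ hs (smooth_leS hTf)) _.
have Cs : 0 <= C * s ^+ k by rewrite mulr_ge0 // exprn_ge0.
have h := sobn_Tj_sub j t1 hf.
have n0 := sob_ge0 (bounded_seminorm_norm E) k.+1 f.
have h' : 4 ^+ k * t * sobn k.+1 f <= 4 ^+ k * s * sobn k.+1 f.
  by rewrite ler_wpM2r // ler_wpM2l // exprn_ge0.
apply: le_trans (ler_wpM2l Cs (le_trans h h')) _.
by rewrite exprSr le_eqVlt; apply/orP; left; apply/eqP; ring.
Qed.

(* [\sum_(i <= k) s^-i dsn s i f]: leaves room for the lower order terms coming
   from commutators. *)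
Fixpoint qsn s (k : nat) f : R :=
  match k with
  | 0 => dsn s 0 f
  | k'.+1 => qsn s k' f + (s ^+ k'.+1)^-1 * dsn s k'.+1 f
  end.

Lemma bounded_seminorm_addZ (p p' : E -> R) c : bounded_seminorm p ->
  bounded_seminorm p' -> 0 <= c -> bounded_seminorm (fun f => p f + c * p' f).
Proof.
move=> hp hp' c0; split.
- move=> x y; have := bsn_leD hp x y; have := ler_wpM2l c0 (bsn_leD hp' x y); lra.
- by move=> a x; rewrite (bsnZ hp) (bsnZ hp'); ring.
- have [_ _ [C C0 hC]] := hp; have [_ _ [C' C'0 hC']] := hp'.
  exists (C + c * C'); first by rewrite addr_ge0 // mulr_ge0.
  by move=> x; have := hC x; have := ler_wpM2l c0 (hC' x); lra.
Qed.

Lemma qsn_bsn s k : 0 < s -> bounded_seminorm (qsn s k).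
Proof.
move=> s0; elim: k => [|k IH]; first exact: dsn_bsn (ltW s0).
apply: bounded_seminorm_addZ => //; first exact: dsn_bsn (ltW s0).
by rewrite invr_ge0 exprn_ge0 // ltW.
Qed.

Lemma qsn_leS s k f : 0 < s -> qsn s k f <= qsn s k.+1 f.
Proof.
move=> s0; rewrite /= lerDl mulr_ge0 ?dsn_ge0 ?(ltW s0) //.
by rewrite invr_ge0 exprn_ge0 // ltW.
Qed.

Lemma qsn_le s k k' f : 0 < s -> (k <= k')%N -> qsn s k f <= qsn s k' f.
Proof.
move=> s0 /subnKC <-; elim: (k' - k)%N => [|n IH]; first by rewrite addn0.
by rewrite addnS; apply: le_trans IH (qsn_leS _ _ s0).
Qed.

(** The weights s^-i are tuned so that raising the order of every difference by one is worth exactly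
    a factor s. *)
Lemma qsn_Tj_sub s k j t f : 0 < s -> 0 <= t <= s ->
  qsn s k (Tj T j t f - f) <= s * qsn s k.+1 f.
Proof.
move=> s0 hts; have sn0 : s != 0 by rewrite lt0r_neq0.
elim: k => [|k IH].
  rewrite [leLHS]/= [qsn s 1 f]/= expr1 mulrDr mulrA divff // mul1r.
  apply: le_trans (dsn_Tj_sub _ _ _ hts) _.
  by rewrite lerDr mulr_ge0 ?dsn_ge0 ?(ltW s0).
have -> : qsn s k.+2 f = qsn s k.+1 f + (s ^+ k.+2)^-1 * dsn s k.+2 f by [].
rewrite [leLHS]/= mulrDr lerD //.
have -> : s * ((s ^+ k.+2)^-1 * dsn s k.+2 f) = (s ^+ k.+1)^-1 * dsn s k.+2 f.
  by rewrite mulrA exprS invfM mulrA divff // mul1r.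
apply: ler_wpM2l; last exact: dsn_Tj_sub.
by rewrite invr_ge0 exprn_ge0 // ltW.
Qed.

(** * Operators that respect the difference seminorms *)

Definition dsn_bounded (L : R -> E -> E) : Prop :=
  forall k, exists2 C, 1 <= C & forall s f, 0 < s <= 1 / 2 ->
    dsn s k (L s f) <= C * dsn s k f.

Lemma dsn_bounded_qsn L : dsn_bounded L ->
  forall k, exists2 C, 1 <= C & forall s f, 0 < s <= 1 / 2 ->
    qsn s k (L s f) <= C * qsn s k f.
Proof.
move=> hL; elim=> [|k [C C1 hC]]; first exact: hL 0%N.
have [C' C'1 hC'] := hL k.+1; exists (C + C'); first lra.
move=> s f hs; have /andP[s0 s2] := hs.
have d0 := dsn_ge0 k.+1 f (ltW s0); have q0 := bsn_ge0 (qsn_bsn k s0) f.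
have i0 : 0 <= (s ^+ k.+1)^-1 by rewrite invr_ge0 exprn_ge0 // ltW.
have := hC _ f hs; have := ler_wpM2l i0 (hC' _ f hs).
have := mulr_ge0 i0 d0; rewrite /=; set i := _^-1; nra.
Qed.

Lemma qsn_Tj k : exists2 C, 1 <= C & forall s, 0 < s <= 1 / 2 ->
  forall j t f, 0 <= t <= s -> qsn s k (Tj T j t f) <= C * qsn s k f.
Proof.
elim: k => [|k [C C1 hC]]; first exact: dsn_Tj 0%N.
have [C' C'1 hC'] := dsn_Tj k.+1; exists (C + C'); first lra.
move=> s hs j t f hts; have /andP[s0 s2] := hs.
have d0 := dsn_ge0 k.+1 f (ltW s0); have q0 := bsn_ge0 (qsn_bsn k s0) f.
have i0 : 0 <= (s ^+ k.+1)^-1 by rewrite invr_ge0 exprn_ge0 // ltW.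
have := hC _ hs j t f hts; have := ler_wpM2l i0 (hC' _ hs j t f hts).
have := mulr_ge0 i0 d0; rewrite /=; set i := _^-1; nra.
Qed.

Lemma iter_avgZ j s n c f : 0 < s -> iter n (avg j s) (c *: f) = c *: iter n (avg j s) f.
Proof. by move=> s0; elim: n => //= n ->; rewrite avgZ. Qed.

Lemma iter_avgD j s n f g : 0 < s ->
  iter n (avg j s) (f + g) = iter n (avg j s) f + iter n (avg j s) g.
Proof. by move=> s0; elim: n => //= n ->; rewrite avgD. Qed.

Lemma iter_avg_Tj j s n t f : 0 < s ->
  iter n (avg j s) (Tj T j t f) = Tj T j t (iter n (avg j s) f).
Proof. by move=> s0; elim: n => //= n ->; rewrite avg_Tj. Qed.

Lemma is_gen_iter_avg j s n f : 0 < s -> is_gen j (iter n.+1 (avg j s) f)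
  (s^-1 *: (Tj T j s (iter n (avg j s) f) - iter n (avg j s) f)).
Proof. by move=> s0; exact: is_gen_avg. Qed.

(** Leibniz rule: each of the n factors contributes the commutator T_2(s) - M_2, which commutes with
    the remaining factors. For n = 0 the truncated [n.-1] is harmless because of the coefficient
    n. *)
Lemma is_gen1_iter_avg2 s n g d : 0 < s -> is_gen false g d ->
  is_gen false (iter n (avg true s) g) (iter n (avg true s) d +
    n%:R *: (Tj T true s (iter n.-1 (avg true s) g) - iter n (avg true s) g)).
Proof.
move=> s0 hg; elim: n => [|n IH]; first by rewrite /= scale0r addr0.
have := is_gen1_avg2 s0 IH; rewrite iterS; congr (is_gen _ _ _).
rewrite avgD // avgZ // avgB // avg_Tj // -natr1.
by case: n {IH} => [|n] /=; lmod.
Qed.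

(** * Smoothing and the K-functional *)

(** M_2^b M_1^a in this order: A_2 meets an average of its own group at once, and A_1 has to cross
    only M_2, where the commutator is explicit. *)
Definition steklov s (b a : nat) f : E :=
  iter b (avg true s) (iter a (avg false s) f).

Lemma steklovZ s (b a : nat) c f : 0 < s -> steklov s b a (c *: f) = c *: steklov s b a f.
Proof. by move=> s0; rewrite /steklov !iter_avgZ. Qed.

Lemma steklovD s (b a : nat) f g : 0 < s ->
  steklov s b a (f + g) = steklov s b a f + steklov s b a g.
Proof. by move=> s0; rewrite /steklov !iter_avgD. Qed.

Lemma is_gen2_steklov s (b a : nat) f : 0 < s -> is_gen true (steklov s b.+1 a f)
  (s^-1 *: (Tj T true s (steklov s b a f) - steklov s b a f)).
Proof. exact: is_gen_iter_avg. Qed.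

Lemma is_gen1_steklov s (b a : nat) f : 0 < s -> is_gen false (steklov s b a.+1 f)
  (steklov s b a (s^-1 *: (Tj T false s f - f)) +
   b%:R *: (Tj T true s (steklov s b.-1 a.+1 f) - steklov s b a.+1 f)).
Proof.
move=> s0; apply: is_gen1_iter_avg2 => //.
have := is_gen_iter_avg false a f s0; congr (is_gen _ _ _).
by rewrite iter_avgZ // -[- f]scaleN1r iter_avgD // iter_avgZ // iter_avg_Tj // scaleN1r.
Qed.

Lemma dsn_bounded_comp L L' : dsn_bounded L -> dsn_bounded L' ->
  dsn_bounded (fun s f => L s (L' s f)).
Proof.
move=> hL hL' k; have [C C1 hC] := hL k; have [C' C'1 hC'] := hL' k.
exists (C * C'); first nra.
move=> s f hs; apply: le_trans (hC _ _ hs) _; rewrite -mulrA ler_wpM2l ?hC' //; lra.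
Qed.

Lemma dsn_boundedD L L' : dsn_bounded L -> dsn_bounded L' ->
  dsn_bounded (fun s f => L s f + L' s f).
Proof.
move=> hL hL' k; have [C C1 hC] := hL k; have [C' C'1 hC'] := hL' k.
exists (C + C'); first lra.
move=> s f hs; have /andP[s0 _] := hs.
apply: le_trans (bsn_leD (dsn_bsn k (ltW s0)) _ _) _.
by rewrite mulrDl lerD ?hC ?hC'.
Qed.

Lemma dsn_bounded_id : dsn_bounded (fun=> id).
Proof. by move=> k; exists 1 => // s f _; rewrite mul1r. Qed.

Lemma dsn_bounded_iter n L : dsn_bounded L -> dsn_bounded (fun s => iter n (L s)).
Proof.
move=> hL; elim: n => [|n IH]; first exact: dsn_bounded_id.
exact: dsn_bounded_comp hL IH.
Qed.

Definition dsn_approx (L : R -> E -> E) : Prop :=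
  dsn_bounded L /\ forall k, exists2 C, 1 <= C & forall s f, 0 < s <= 1 / 2 ->
    dsn s k (L s f - f) <= C * dsn s k.+1 f.

Lemma dsn_approx_id : dsn_approx (fun=> id).
Proof.
split; first exact: dsn_bounded_id.
move=> k; exists 1 => // s f /andP[s0 _].
by rewrite subrr (bsn0 (dsn_bsn k (ltW s0))) mul1r dsn_ge0 // ltW.
Qed.

Lemma dsn_approx_comp L L' : dsn_approx L -> dsn_approx L' ->
  dsn_approx (fun s f => L s (L' s f)).
Proof.
move=> [hL aL] [hL' aL']; split; first exact: dsn_bounded_comp.
move=> k; have [C C1 hC] := aL k; have [D D1 hD] := aL' k.
have [B B1 hB] := hL' k.+1; exists (C * B + D); first nra.
move=> s f hs; have /andP[s0 _] := hs.
have -> : L s (L' s f) - f = (L s (L' s f) - L' s f) + (L' s f - f) by lmod.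
apply: le_trans (bsn_leD (dsn_bsn k (ltW s0)) _ _) _.
rewrite mulrDl lerD ?hD //; apply: le_trans (hC _ _ hs) _.
by rewrite -mulrA ler_wpM2l ?hB //; lra.
Qed.

Lemma dsn_approx_avg j : dsn_approx (avg j).
Proof.
split=> k.
  have [C C1 hC] := dsn_Tj k; exists C => // s f hs; have /andP[s0 _] := hs.
  apply: avg_seminorm (dsn_bsn k (ltW s0)) s0 _ => t ht; exact: hC.
exists 1 => // s f /andP[s0 _]; rewrite mul1r.
apply: avg_sub_seminorm (dsn_bsn k (ltW s0)) s0 _ => t ht; exact: dsn_Tj_sub.
Qed.

Lemma dsn_approx_iter n L : dsn_approx L -> dsn_approx (fun s => iter n (L s)).
Proof.
move=> hL; elim: n => [|n IH]; first exact: dsn_approx_id.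
exact: dsn_approx_comp hL IH.
Qed.

Lemma dsn_approx_steklov (b a : nat) : dsn_approx (fun s => steklov s b a).
Proof.
apply: (dsn_approx_comp (L := fun s => iter b (avg true s))
  (L' := fun s => iter a (avg false s))); exact/dsn_approx_iter/dsn_approx_avg.
Qed.

(* Every order of smoothness costs one average of each kind and is paid for by
   one more order of difference. *)
Lemma sob_steklov (m k b a : nat) : (m <= b)%N -> (m <= a)%N -> exists2 C, 0 <= C &
  forall s f, 0 < s <= 1 / 2 -> smooth m (steklov s b a f) /\
    sob (qsn s k) m (steklov s b a f) <= C * qsn s (m + k) f.
Proof.
elim: m k b a => [|m IH] k b a.
  move=> _ _; have [C C1 hC] := dsn_bounded_qsn (dsn_approx_steklov b a).1 k.
  by exists C; [lra|move=> s f hs; split=> //; exact: hC].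
case: b => // b; case: a => // a mb ma.
have [C0 C01 hC0] := dsn_bounded_qsn (dsn_approx_steklov b.+1 a.+1).1 k.
(* [C1], [C2] and [C3] serve the three terms of A_1: in the first the difference acts on [f] itself,
   the other two are commutator terms. For A_2 the difference T_2(s) - I stands outside the
   averages; [C4] is therefore taken at [k.+1], and [sob_Tj_sub] trades that extra order for the
   factor s. *)
have [C1 C10 hC1] := IH k b.+1 a (leqW mb) ma.
have [C2 C20 hC2] := IH k b a.+1 mb (leqW ma).
have [C3 C30 hC3] := IH k b.+1 a.+1 (leqW mb) (leqW ma).
have [C4 C40 hC4] := IH k.+1 b a.+1 mb (leqW ma).
have [CT CT1 hCT] := qsn_Tj k.
have c30 : 0 <= CT * 3 ^+ m by rewrite mulr_ge0 ?exprn_ge0 //; lra.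
exists (C0 + (C1 + b.+1%:R * (CT * 3 ^+ m * C2 + C3) + CT * 3 ^+ m * C4)).
  by rewrite addr_ge0 ?addr_ge0 ?mulr_ge0 ?addr_ge0 ?mulr_ge0 //; lra.
move=> s f hs; have /andP[s0 s2] := hs; have sge0 := ltW s0.
have s1 : 0 <= s <= 1 by lra.
have ss : 0 <= s <= s by rewrite sge0 lexx.
have hq := qsn_bsn k s0; have hq1 := qsn_bsn k.+1 s0.
have hT g : qsn s k (Tj T true s g) <= CT * qsn s k g by apply: hCT.
have [s_1 h1] := hC1 s (s^-1 *: (Tj T false s f - f)) hs.
have [s_2 h2] := hC2 s f hs.
have [s_3 h3] := hC3 s f hs.
have [s_4 h4] := hC4 s f hs.
have s_2T := smooth_Tj true sge0 s_2.
have g1 := is_gen1_steklov b.+1 a f s0; have g2 := is_gen2_steklov b a.+1 f s0.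
have s_d1 := smoothD s_1 (smoothZ b.+1%:R (smoothB s_2T s_3)).
have s_d2 := smoothZ s^-1 (smoothB s_2T s_2).
split; first by move=> [|]; [split; [exact: is_gen_Adom g2|rewrite (AopE g2)]
  |split; [exact: is_gen_Adom g1|rewrite (AopE g1)]].
set Q := qsn s (m.+1 + k) f.
have Q0 : 0 <= Q by apply: bsn_ge0; exact: qsn_bsn.
have hQ n : (n <= m.+1 + k)%N -> qsn s n f <= Q by move=> ?; exact: qsn_le.
have e0 : qsn s k (steklov s b.+1 a.+1 f) <= C0 * Q.
  by apply: le_trans (hC0 _ _ hs) _; rewrite ler_wpM2l ?hQ ?leq_addl //; lra.
have e1 : sob (qsn s k) m (steklov s b.+1 a (s^-1 *: (Tj T false s f - f))) <= C1 * Q.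
  apply: le_trans h1 _; rewrite ler_wpM2l //.
  rewrite (bsnZ (qsn_bsn _ s0)) gtr0_norm ?invr_gt0 // ler_pdivrMl //.
  exact: qsn_Tj_sub.
have e2 : sob (qsn s k) m (Tj T true s (steklov s b a.+1 f)) <= CT * 3 ^+ m * C2 * Q.
  apply: le_trans (sob_Tj hq s1 _ hT s_2) _; first lra.
  rewrite -[leRHS]mulrA ler_wpM2l //; apply: le_trans h2 _.
  by rewrite ler_wpM2l // hQ.
have e3 : sob (qsn s k) m (steklov s b.+1 a.+1 f) <= C3 * Q.
  by apply: le_trans h3 _; rewrite ler_wpM2l // hQ.
have e4 : sob (qsn s k) m (s^-1 *: (Tj T true s (steklov s b a.+1 f) - steklov s b a.+1 f))
    <= CT * 3 ^+ m * C4 * Q.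
  rewrite (sobZ hq) ?gtr0_norm ?invr_gt0 // ?ler_pdivrMl //; last exact: smoothB.
  apply: le_trans (sob_Tj_sub hq hq1 ss _ CT1 hT _ _ s_2) _.
  - by case/andP: s1.
  - move=> g; apply: le_trans (qsn_Tj_sub _ _ _ s0 ss) _.
    by rewrite -mulrA ler_peMl // mulr_ge0 // (bsn_ge0 hq1).
  - by move=> g; exact: qsn_leS.
  have -> : s * (CT * 3 ^+ m * C4 * Q) = CT * 3 ^+ m * s * (C4 * Q) by ring.
  apply: ler_wpM2l; first exact: mulr_ge0.
  by apply: le_trans h4 _; rewrite ler_wpM2l // hQ // addnS.
rewrite [leLHS]/= (AopE g1) (AopE g2).
have := sobD hq s_1 (smoothZ b.+1%:R (smoothB s_2T s_3)).
rewrite [sob _ _ (b.+1%:R *: _)](sobZ hq) ?normr_nat; last exact: smoothB.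
have := ler_wpM2l (ler0n R b.+1) (sobB hq s_2T s_3).
have := ler_wpM2l (ler0n R b.+1) (lerD e2 e3).
move=> k1 k2 k3.
have -> : (C0 + (C1 + b.+1%:R * (CT * 3 ^+ m * C2 + C3) + CT * 3 ^+ m * C4)) * Q =
  C0 * Q + ((C1 * Q + b.+1%:R * (CT * 3 ^+ m * C2 * Q + C3 * Q)) + CT * 3 ^+ m * C4 * Q).
  ring.
apply: lerD => //; apply: lerD => //.
apply: le_trans k3 _; apply: lerD => //; exact: le_trans k2 k1.
Qed.

Definition steklov_defect r s n f : E := iter n (fun g => g - steklov s r r g) f.

Lemma dsn_bounded_defect r n : dsn_bounded (fun s => steklov_defect r s n).
Proof.
apply: (dsn_bounded_iter n (L := fun s g => g - steklov s r r g)) => k; have [C C1 hC] := (dsn_approx_steklov r r).1 k.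
exists (1 + C); first lra.
move=> s f hs; have /andP[s0 _] := hs.
apply: le_trans (bsn_leB (dsn_bsn k (ltW s0)) _ _) _.
by rewrite mulrDl mul1r lerD2l hC.
Qed.

Lemma dsn_defect r n k : exists2 C, 1 <= C & forall s f, 0 < s <= 1 / 2 ->
  dsn s k (steklov_defect r s n f) <= C * dsn s (n + k) f.
Proof.
elim: n k => [|n IH] k; first by exists 1 => // s f _; rewrite mul1r.
have [C C1 hC] := (dsn_approx_steklov r r).2 k; have [D D1 hD] := IH k.+1.
exists (C * D); first nra.
move=> s f hs; have /andP[s0 _] := hs; rewrite /steklov_defect iterS -/(steklov_defect r s n f).
rewrite -(bsnN (dsn_bsn k (ltW s0))) opprB; apply: le_trans (hC _ _ hs) _.
by rewrite -mulrA ler_wpM2l ?(le_trans ler01) // addSnnS hD.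
Qed.

(* The approximant [(I - (I - P)^r) f = P (sum_(i < r) (I - P)^i f)] with
   [P = steklov s r r]. *)
Fixpoint defect_sum r s n f : E :=
  match n with
  | 0 => 0
  | n'.+1 => defect_sum r s n' f + steklov_defect r s n' f
  end.

Lemma dsn_bounded_defect_sum r n : dsn_bounded (fun s => defect_sum r s n).
Proof.
elim: n => [|n IH] /=; last exact: dsn_boundedD IH (dsn_bounded_defect r n).
move=> k; exists 1 => // s f /andP[s0 _].
by rewrite mul1r (bsn0 (dsn_bsn k (ltW s0))) dsn_ge0 // ltW.
Qed.

(** The geometric sum identity for P. It exhibits the approximant as P applied to something, which
    makes [sob_steklov] applicable, and its error as a power of I - P. *)
Lemma steklov_defect_sum r s n f : 0 < s ->
  f - steklov s r r (defect_sum r s n f) = steklov_defect r s n f.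
Proof.
move=> s0; elim: n => [|n IH].
  by rewrite /= -(scale0r (0 : E)) steklovZ // !scale0r subr0.
by rewrite /= steklovD // opprD addrA IH.
Qed.

(** Split f = (f - g) + g: differences of f - g are bounded by its norm, those of g by its
    derivatives. After multiplication by s^r the weights become s^(r-i) <= 1. *)
Lemma qsn_smooth r k : (k <= r)%N -> exists2 C, 0 <= C &
  forall s f g, 0 < s <= 1 / 2 -> smooth r g ->
    s ^+ r * qsn s k f <= C * (`|f - g| + s ^+ r * sobn r g).
Proof.
have hn := bounded_seminorm_norm E.
have key i : (i <= r)%N -> exists2 C, 0 <= C &
  forall s f g, 0 < s <= 1 / 2 -> smooth r g ->
    s ^+ r * ((s ^+ i)^-1 * dsn s i f) <= C * (`|f - g| + s ^+ r * sobn r g).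
  move=> ir; have [C C0 hC] := dsn_smooth i.
  exists (2 ^+ i + C); first by rewrite addr_ge0 // exprn_ge0.
  move=> s f g hs hg; have /andP[s0 s2] := hs; have hs1 : 0 <= s <= 1 by lra.
  have hgi : smooth i g.
    move: hg; rewrite -(subnKC ir); elim: (r - i)%N => [|n IH]; first by rewrite addn0.
    by rewrite addnS => /smooth_leS.
  have sgi : sobn i g <= sobn r g.
    rewrite -(subnKC ir); elim: (r - i)%N => [|n IH]; first by rewrite addn0.
    by rewrite addnS; apply: le_trans IH (sob_leS hn _ _).
  have si : 0 < s ^+ i by rewrite exprn_gt0.
  have sr : s ^+ r = s ^+ i * s ^+ (r - i) by rewrite -exprD subnKC.
  have sri0 : 0 <= s ^+ (r - i) by rewrite exprn_ge0 // ltW.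
  have sri1 : s ^+ (r - i) <= 1 by rewrite exprn_ile1 // ltW; lra.
  have -> : s ^+ r * ((s ^+ i)^-1 * dsn s i f) = s ^+ (r - i) * dsn s i f.
    by rewrite sr; field; rewrite lt0r_neq0.
  have h : dsn s i f <= 2 ^+ i * `|f - g| + C * s ^+ i * sobn r g.
    have -> : f = (f - g) + g by lmod.
    apply: le_trans (bsn_leD (dsn_bsn i (ltW s0)) _ _) _.
    have -> : f - g + g - g = f - g by lmod.
    rewrite lerD ?dsn_le_norm ?(ltW s0) //; apply: le_trans (hC _ _ hs1 hgi) _.
    by rewrite ler_wpM2l // mulr_ge0 // ltW.
  apply: le_trans (ler_wpM2l sri0 h) _; rewrite mulrDr mulrDl; apply: lerD.
    apply: le_trans (ler_piMl _ sri1) _; first by rewrite mulr_ge0 ?exprn_ge0.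
    rewrite ler_wpM2l ?exprn_ge0 // lerDl mulr_ge0 ?exprn_ge0 ?(ltW s0) //.
    exact: sob_ge0.
  have -> : s ^+ (r - i) * (C * s ^+ i * sobn r g) = C * (s ^+ r * sobn r g).
    by rewrite sr; ring.
  by rewrite ler_wpM2l // lerDr.
elim: k => [|k IH] kr.
  have [C C0 hC] := key 0%N kr; exists C => // s f g hs hg.
  by have := hC s f g hs hg; rewrite expr0 invr1 mul1r.
have [C C0 hC] := IH (ltnW kr); have [D D0 hD] := key _ kr.
exists (C + D); first exact: addr_ge0.
move=> s f g hs hg; rewrite /= mulrDr mulrDl.
by apply: lerD; [exact: hC|exact: hD].
Qed.

Lemma smooth_approximation r : exists2 C, 0 <= C & forall s f, 0 < s <= 1 / 2 ->
  exists g, smooth r.+1 g /\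
    `|f - g| + s ^+ r.+1 * sobn r.+1 g <= C * (dsn s r.+1 f + s ^+ r.+1 * `|f|).
Proof.
have hn := bounded_seminorm_norm E.
have [Ca Ca1 hCa] := dsn_defect r.+1 r.+1 0.
have [C1 C10 hC1] := sob_steklov 0 (leqnn r.+1) (leqnn r.+1).
have [C2 C21 hC2] := dsn_bounded_qsn (dsn_bounded_defect_sum r.+1 r.+1) r.+1.
have [C3 C30 hC3] := qsn_smooth (leqnn r).
pose B := C1 * C2 * (C3 + 1).
have B0 : 0 <= B by rewrite !mulr_ge0 //; lra.
(* With this interpolation parameter the lower order norm returns at most half of [S * N], because
   B/(2 (B + 1)) <= 1/2. *)
have e0 : 0 < 1 / (2 * (B + 1)) by rewrite divr_gt0 //; lra.
have [D D0 hD] := sobn_interpolation r e0.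
exists (Ca + 2 * (B * (Ca + D + D * Ca + 1))).
  by rewrite addr_ge0 ?mulr_ge0 ?addr_ge0 ?mulr_ge0 //; lra.
move=> s f hs; have /andP[s0 s2] := hs; have sge0 := ltW s0.
pose g := steklov s r.+1 r.+1 (defect_sum r.+1 s r.+1 f); exists g.
have [hg hN] := hC1 s (defect_sum r.+1 s r.+1 f) hs; split; first exact: hg.
rewrite -/g in hg hN; rewrite addn0 in hN.
set p := dsn s r.+1 f; have p0 : 0 <= p by exact: dsn_ge0.
have hfg : `|f - g| <= Ca * p.
  by rewrite steklov_defect_sum // -(dsn0E _ sge0); have := hCa s f hs; rewrite addn0.
set N := sobn r.+1 g.
have {}hN : N <= C1 * C2 * qsn s r.+1 f.
  have NE : N <= sob (qsn s 0) r.+1 g.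
    by apply: sob_mono => v; rewrite /= dsn0E.
  by apply: le_trans NE (le_trans hN _); rewrite -mulrA ler_wpM2l // hC2.
have N0 : 0 <= N by exact: sob_ge0.
set S := s ^+ r.+1; have S0 : 0 < S by exact: exprn_gt0.
have S1 : S <= 1 by apply: exprn_ile1; lra.
have hn' := hD g hg; rewrite -/N in hn'.
have n0 := sob_ge0 hn r g; set n := sobn r g in hn' n0.
have hq : S * qsn s r.+1 f <= C3 * (`|f - g| + S * n) + p.
  have -> : qsn s r.+1 f = qsn s r f + S^-1 * p by [].
  rewrite mulrDr mulrA divff ?lt0r_neq0 // mul1r lerD2r.
  (* One factor s is set aside so that [qsn_smooth] is used at order r. Given back to s^r it makes
     S, and in front of |f - g| it is at most 1. *)
  rewrite /S exprS -!mulrA; apply: le_trans (ler_wpM2l sge0 (hC3 s f g hs (smooth_leS hg))) _.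
  rewrite mulrCA mulrDr; apply: ler_wpM2l => //.
  by rewrite lerD2r ler_piMl //; lra.
have SN : S * N <= B * (Ca * p + S * n + p).
  have := ler_wpM2l (ltW S0) hN.
  have -> : S * (C1 * C2 * qsn s r.+1 f) = C1 * C2 * (S * qsn s r.+1 f) by ring.
  have C120 : 0 <= C1 * C2 by apply: mulr_ge0 => //; lra.
  move/le_trans; apply; rewrite /B -[leRHS]mulrA; apply: ler_wpM2l => //.
  apply: le_trans hq _.
  have Sn0 : 0 <= S * n by apply: mulr_ge0; [exact: ltW|].
  have := ler_wpM2l C30 hfg; have := mulr_ge0 C30 p0.
  have := mulr_ge0 (le_trans ler01 Ca1) p0; lra.
have hgf : `|g| <= `|f| + Ca * p.
  have -> : g = f - (f - g) by lmod.
  by apply: le_trans (ler_normB _ _) _; rewrite lerD2l.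
have hSn : S * n <= 1 / (2 * (B + 1)) * (S * N) + D * (S * `|f| + Ca * p).
  apply: le_trans (ler_wpM2l (ltW S0) hn') _.
  rewrite mulrDr lerD //; first by rewrite mulrCA.
  rewrite mulrCA ler_wpM2l //; apply: le_trans (ler_wpM2l (ltW S0) hgf) _.
  by rewrite mulrDr lerD2l ler_piMl // mulr_ge0 //; lra.
have hB : B * (1 / (2 * (B + 1)) * (S * N)) <= 1 / 2 * (S * N).
  rewrite mulrA ler_wpM2r ?mulr_ge0 ?(ltW S0) //.
  by rewrite mulrA mulr1 ler_pdivrMr; lra.
have Sf0 : 0 <= S * `|f| by rewrite mulr_ge0 // ltW.
(* The absorption: half of [S * N] moves to the left side, which produces the factor 2. *)
have SN' : S * N <= 2 * (B * (Ca * p + D * (S * `|f| + Ca * p) + p)).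
  have := ler_wpM2l B0 hSn; rewrite mulrDr; lra.
apply: le_trans (lerD hfg SN') _.
have BCD : B * (Ca * p + D * (S * `|f| + Ca * p) + p) <=
    B * (Ca + D + D * Ca + 1) * (p + S * `|f|).
  rewrite -mulrA ler_wpM2l //.
  have := mulr_ge0 D0 p0; have := mulr_ge0 (mulr_ge0 D0 (le_trans ler01 Ca1)) Sf0.
  have := mulr_ge0 (le_trans ler01 Ca1) Sf0; lra.
have := mulr_ge0 (le_trans ler01 Ca1) Sf0; lra.
Qed.

(** * Translation to the notions of the statement and final estimates *)

Lemma wdom_rcons w j g : wdom T (rcons w j) g <-> Adom T j g /\ wdom T w (Aop T j g).
Proof.
elim: w => [|i w IH] /=; first by split=> -[].
have -> : wapp T (rcons w j) g = wapp T w (Aop T j g) by rewrite /wapp foldr_rcons.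
by split=> [[/IH[h1 h2] h3]|[h1 [h2 h3]]]; [|split=> //; apply/IH].
Qed.

Lemma inEr_smooth r g : inEr T r g <-> smooth r g.
Proof.
elim: r g => [|r IH] g.
  by split=> // _ w; case: w.
split=> [h j|h w].
  have [h1 _] : wdom T [:: j] g /\ True by split=> //; apply: h.
  case: (h1) => _ hj; split; first exact: hj.
  apply/IH => w /andP[w1 wr]; have := h (rcons w j); rewrite size_rcons /= ltnS => /(_ wr).
  by case/wdom_rcons.
case/lastP: w => // w j; rewrite size_rcons /= ltnS => wr.
have [hj hs] := h j; apply/wdom_rcons; split=> //.
have /IH hw := hs; case: w wr => // i w wr; exact: hw.
Qed.

(** Splitting by the last letter, the generator applied first, matches the recursion of [sob]. *)
Lemma sum_tuple_rcons (F : seq bool -> R) (k : nat) :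
  \sum_(w : k.+1.-tuple bool) F w =
  \sum_(w : k.-tuple bool) F (rcons w false) + \sum_(w : k.-tuple bool) F (rcons w true).
Proof.
rewrite (reindex (fun q : bool * k.-tuple bool => [tuple of rcons q.2 q.1])) /=; last first.
  apply: onW_bij; apply: inj_card_bij.
    move=> [i v] [j w] /= /(congr1 val) /= /rcons_inj[vw ->].
    by congr (_, _); apply: val_inj.
  by rewrite card_prod !card_tuple card_bool expnS.
rewrite -(pair_bigA _ (fun i (w : k.-tuple bool) => F (rcons w i))) /=.
by rewrite big_bool /= addrC.
Qed.

Lemma normEr_sobn r g : normEr T r g = sobn r g.
Proof.
pose W (k : nat) g := \sum_(w : k.-tuple bool) `|wapp T w g|.
have W0 h : W 0 h = `|h|.
  rewrite /W (bigD1 [tuple]) //= big1 ?addr0 // => w.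
  by rewrite tuple0 => /eqP.
have WS k h : W k.+1 h = W k (Aop T false h) + W k (Aop T true h).
  rewrite /W (sum_tuple_rcons (fun w => `|wapp T w h|)).
  by congr (_ + _); apply: eq_bigr => w _; rewrite /wapp foldr_rcons.
suff -> : normEr T r g = \sum_(0 <= k < r.+1) W k g.
  elim: r g => [|r IH] g; first by rewrite big_nat1 W0.
  rewrite big_nat_recl // W0 /= -!IH -big_split /=; congr (_ + _).
  by apply: eq_bigr => k _; rewrite WS.
by rewrite /normEr [in RHS]big_ltn // W0.
Qed.

Lemma Omega_le r s f : 0 <= s -> Omega T r s f <= 2 ^+ r * dsn s r f.
Proof.
move=> s0; have -> : 2 ^+ r * dsn s r f = \sum_(w : r.-tuple bool) dsn s r f.
  by rewrite sumr_const card_tuple card_bool -[RHS]mulr_natl natrX.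
apply: ler_sum => w _; apply: ge_sup.
  exists `|dapp T (zip w [tuple of nseq r 0]) f|, [tuple of nseq r 0]; split=> // i.
  by rewrite (tnth_nth 0) /= nth_nseq; case: ifP; rewrite lexx s0.
move=> _ [ts [hts ->]]; apply: dsn_ge; split.
  by rewrite size_zip !size_tuple minnn.
apply/(all_nthP (false, 0)) => i; rewrite size_zip !size_tuple minnn => ir.
rewrite nth_zip ?size_tuple //=.
by have := hts (Ordinal ir); rewrite (tnth_nth 0).
Qed.

(** A list of steps determines its word. The supremum for that word is one summand of [Omega], and
    the other summands are nonnegative. *)
Lemma dsn_le_Omega r s f : 0 <= s -> dsn s r f <= Omega T r s f.
Proof.
move=> s0; apply: dsn_le => // l [lr hl].
pose A (w : r.-tuple bool) := [set x : R | exists ts : r.-tuple R,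
  (forall i : 'I_r, 0 <= tnth ts i <= s) /\ x = `|dapp T (zip w ts) f|].
have ubA w : has_ubound (A w).
  exists (2 ^+ r * `|f|) => _ [ts [_ ->]]; apply: le_trans (dapp_norm _ _) _.
  by rewrite size_zip !size_tuple minnn.
have supA w : 0 <= sup (A w).
  pose z := [tuple of nseq r (0 : R)].
  apply: le_trans (normr_ge0 (dapp T (zip w z) f)) _; apply: ub_le_sup => //.
  exists z; split=> // i.
  by rewrite (tnth_nth 0) /= nth_nseq; case: ifP; rewrite lexx s0.
have sw : size (unzip1 l) == r by rewrite size_map lr.
have st : size (unzip2 l) == r by rewrite size_map lr.
rewrite /Omega (bigD1 (Tuple sw)) //=.
apply: (@le_trans _ _ (sup (A (Tuple sw)))); last first.
  by rewrite lerDl; apply: sumr_ge0 => w _; exact: supA.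
apply: ub_le_sup => //; exists (Tuple st); split; last by rewrite /= zip_unzip.
move=> i; rewrite (tnth_nth 0) /= (nth_map (false, 0)) ?lr //.
by move/(all_nthP (false, 0)): hl; apply; rewrite lr.
Qed.

Lemma normEr_ge0 r g : 0 <= normEr T r g.
Proof. by rewrite normEr_sobn sob_ge0 //; exact: bounded_seminorm_norm. Qed.

Lemma norm_le_normEr r g : `|g| <= normEr T r g.
Proof. by rewrite normEr_sobn; exact: sob_ge (bounded_seminorm_norm _) _ _. Qed.

Lemma Kfun_le r t f g : 0 <= t -> inEr T r g -> Kfun T r t f <= `|f - g| + t * normEr T r g.
Proof.
move=> t0 hg; apply: ge_inf; last by exists g.
by exists 0 => _ [h [_ ->]]; rewrite addr_ge0 // mulr_ge0 // normEr_ge0.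
Qed.

Lemma inEr0 r : inEr T r 0. Proof. by apply/inEr_smooth/smooth0. Qed.

Lemma Kfun_ge r t f c :
  (forall g, inEr T r g -> c <= `|f - g| + t * normEr T r g) -> c <= Kfun T r t f.
Proof.
move=> h; apply: lb_le_inf; last by move=> _ [g [hg ->]]; exact: h.
(* A lower bound passes to [inf] only for a nonempty set; the decomposition with f_1 = 0 is always
   available. *)
by exists (`|f - 0| + t * normEr T r 0), 0; split=> //; exact: inEr0.
Qed.

Lemma normEr0 r : normEr T r 0 = 0.
Proof.
have := sobZ (bounded_seminorm_norm E) 0 (smooth0 r).
by rewrite scale0r normr0 mul0r normEr_sobn.
Qed.

Lemma Kfun_le_norm r t f : 0 <= t -> Kfun T r t f <= `|f|.
Proof.
by move=> t0; have := Kfun_le f t0 (@inEr0 r); rewrite subr0 normEr0 mulr0 addr0.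
Qed.

Lemma dsn_le_Kfun r : exists2 C, 0 < C & forall s f, 0 < s ->
  dsn s r f <= C * Kfun T r (s ^+ r) f.
Proof.
have [C C0 hC] := dsn_smooth r.
have p0 : 0 < 2 ^+ r :> R by rewrite exprn_gt0.
exists (2 ^+ r + C); first lra.
move=> s f s0; have sr0 : 0 < s ^+ r by exact: exprn_gt0.
have C'0 : 0 < 2 ^+ r + C by lra.
rewrite mulrC -ler_pdivrMr //; apply: Kfun_ge => g hg; rewrite ler_pdivrMr // mulrC.
have n0 := normEr_ge0 r g; have sn0 := mulr_ge0 (ltW sr0) n0.
have [s1|s1] := leP s 1.
  have hs : 0 <= s <= 1 by rewrite (ltW s0).
  have -> : f = (f - g) + g by lmod.
  apply: le_trans (bsn_leD (dsn_bsn r (ltW s0)) _ _) _.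
  have -> : f - g + g - g = f - g by lmod.
  have h1 := dsn_le_norm r (f - g) (ltW s0).
  have h2 := hC s g hs ((inEr_smooth r g).1 hg).
  rewrite -normEr_sobn in h2.
  have := mulr_ge0 C0 (normr_ge0 (f - g)); have := mulr_ge0 (ltW p0) sn0; lra.
(* For s > 1 smoothness of g is not exploited: s^r >= 1 makes |f| at most the quantity under the
   infimum. *)
apply: le_trans (dsn_le_norm r f (ltW s0)) _.
have h1 : `|f| <= `|f - g| + s ^+ r * normEr T r g.
  have -> : `|f| = `|(f - g) + g| by congr (`|_|); lmod.
  apply: le_trans (ler_normD _ _) _; rewrite lerD2l.
  apply: le_trans (norm_le_normEr r g) _; rewrite ler_peMl //.
  by rewrite exprn_ege1 // ltW.
apply: le_trans (ler_wpM2l (ltW p0) h1) _; rewrite ler_wpM2r //; last lra.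
by rewrite addr_ge0.
Qed.

Lemma Kfun_equivalence r : exists c C : R, 0 < c /\ 0 < C /\
  forall f s, 0 < s ->
    c * Omega T r.+1 s f <= Kfun T r.+1 (s ^+ r.+1) f /\
    Kfun T r.+1 (s ^+ r.+1) f <=
      C * (Omega T r.+1 s f + Num.min (s ^+ r.+1) 1 * `|f|).
Proof.
have [C1 C10 hC1] := dsn_le_Kfun r.+1.
have [C2 C20 hC2] := smooth_approximation r.
have p0 : 0 < 2 ^+ r.+1 :> R by rewrite exprn_gt0.
(* In [c] the power of 2 counts the words in [Omega]. In [C], [C2] serves s <= 1/2 and the power of
   2 serves s > 1/2, where it compensates min(s^(r+1), 1) >= 2^-(r+1). *)
exists (2 ^+ r.+1 * C1)^-1, (C2 + 2 ^+ r.+1); split.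
  by rewrite invr_gt0 mulr_gt0.
split; first lra.
move=> f s s0; have sr0 : 0 < s ^+ r.+1 by exact: exprn_gt0.
have O0 : 0 <= Omega T r.+1 s f.
  exact: le_trans (dsn_ge0 _ _ (ltW s0)) (dsn_le_Omega _ _ (ltW s0)).
split.
  rewrite ler_pdivrMl ?mulr_gt0 // -mulrA.
  apply: le_trans (Omega_le _ _ (ltW s0)) _.
  by rewrite ler_wpM2l ?(ltW p0) // hC1.
have [s2|s2] := leP s (1 / 2).
  have hs : 0 < s <= 1 / 2 by rewrite s0.
  have [g [hg hfg]] := hC2 s f hs.
  have -> : Num.min (s ^+ r.+1) 1 = s ^+ r.+1.
    by apply: min_l; apply: exprn_ile1; lra.
  apply: le_trans (Kfun_le f (ltW sr0) ((inEr_smooth r.+1 g).2 hg)) _.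
  rewrite normEr_sobn; apply: le_trans hfg _.
  have h : dsn s r.+1 f + s ^+ r.+1 * `|f| <= Omega T r.+1 s f + s ^+ r.+1 * `|f|.
    by rewrite lerD2r dsn_le_Omega // ltW.
  apply: le_trans (ler_wpM2l C20 h) _; rewrite ler_wpM2r //; last lra.
  by rewrite addr_ge0 // mulr_ge0 // ltW.
apply: le_trans (Kfun_le_norm _ _ (ltW sr0)) _.
have m0 : 1 <= 2 ^+ r.+1 * Num.min (s ^+ r.+1) 1.
  have [h|h] := leP (s ^+ r.+1) 1.
    by rewrite -exprMn exprn_ege1 //; lra.
  by rewrite mulr1 exprn_ege1 //; lra.
have mf : 0 <= Num.min (s ^+ r.+1) 1 * `|f|.
  by rewrite mulr_ge0 // le_min (ltW sr0) ler01.
have := ler_wpM2r (normr_ge0 f) m0; rewrite mul1r -mulrA => h.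
apply: le_trans h _; have := mulr_ge0 C20 mf; have := mulr_ge0 C20 O0.
have := mulr_ge0 (ltW p0) O0; lra.
Qed.

End Representation.

Unset Implicit Arguments.

Theorem mainTheorem2 (R : realType) (E : completeNormedModType R)
  (T : R -> R -> E -> E) (HT : is_contr_rep_axb T) (r : nat) (hr : (0 < r)%N) :
  exists c C : R, 0 < c /\ 0 < C /\
    forall (f : E) (s : R), 0 < s ->
      c * Omega T r s f <= Kfun T r (s ^+ r) f /\
      Kfun T r (s ^+ r) f <= C * (Omega T r s f + Num.min (s ^+ r) 1 * `|f|).
Proof. by case: r hr => // r _; exact: Kfun_equivalence. Qed.
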